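(* Consider Algorithm (C) (see context). Assume that $f$ is $\mu$-strongly convex with $\mu>0$, that the variances satisfy $\omega_k^2\le\sigma^2$ for all $k\ge1$, and that we target an accuracy $\varepsilon>0$ smaller than $2\sigma^2/\sqrt{\mu L}$. First, use Algorithm (C) with constant step size $\eta_k=1/L$ and $\gamma_0=\mu$ until $\mathbb E[F(x_k)-F^\star]\le2\sigma^2/\sqrt{\mu L}$. Then restart Algorithm (C) from the point obtained, with $\gamma_0=\mu$ and decreasing step sizes $\eta_k=\min\left(\frac1L,\frac4{\mu(k+2)^2}\right)$, generating a new sequence. The resulting total number of gradient evaluations to achieve $\mathbb E[F(x_k)-F^\star]\le\varepsilon$ (with $x_k$ the iterates of the second stage) is upper bounded by $$O\left(\sqrt{\frac L\mu}\log\left(\frac{F(x_0)-F^\star}{\varepsilon}\right)\right)+O\left(\frac{\sigma^2}{\mu\varepsilon}\right),$$ where the $O(\cdot)$ hide absolute constants.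
   Context: Problem: minimize $F=f+\psi$ on $\mathbb R^p$; $f$ is convex, $L$-smooth (differentiable with $L$-Lipschitz gradient) and $\mu$-strongly convex; $\psi:\mathbb R^p\to\mathbb R\cup\{+\infty\}$ is proper convex lower semicontinuous; $x^\star$ is a minimizer of $F$, $F^\star=F(x^\star)$. $\mathrm{Prox}_{\eta\psi}[u]=\arg\min_x\{\eta\psi(x)+\frac12\|x-u\|^2\}$. Algorithm (C): deterministic step sizes $0<\eta_k\le1/L$ ($k\ge0$), parameter $\gamma_0\ge\mu$, $\gamma_0>0$; sequences with $\delta_k=\sqrt{\eta_k\gamma_k}$ for all $k\ge0$ and $\gamma_k=(1-\delta_k)\gamma_{k-1}+\delta_k\mu$ for all $k\ge1$. Start from $y_0=x_0$ and for $k\ge1$ set $x_k=\mathrm{Prox}_{\eta_k\psi}[y_{k-1}-\eta_kg_k]$, where $\mathbb E[g_k\mid\mathcal F_{k-1}]=\nabla f(y_{k-1})$, $y_k=x_k+\beta_k(x_k-x_{k-1})$ with $\beta_k=\frac{\delta_k(1-\delta_k)\eta_{k+1}}{\eta_k\delta_{k+1}+\eta_{k+1}\delta_k^2}$. $\mathcal F_{k-1}$ is the filtration representing all information up to iteration $k-1$, and $\omega_k^2=\mathbb E[\|\nabla f(y_{k-1})-g_k\|^2]$. Each iteration uses one gradient evaluation $g_k$. In the complexity bound $\log$ is understood as $\max(\log,0)$. *)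

(* Defs.v *)
From HB Require Import structures.
From mathcomp Require Import all_boot all_order all_algebra.
From mathcomp Require Import all_classical all_reals all_analysis.

Set Implicit Arguments.
Unset Strict Implicit.
Unset Printing Implicit Defensive.

Import Order.TTheory GRing.Theory Num.Theory.
Import numFieldNormedType.Exports.

Local Open Scope classical_set_scope.
Local Open Scope ring_scope.

(* The library norm on ['rV[R]_p] is the sup norm; the Euclidean one is needed
   here. Both induce the topology used by [differentiable], [open] and
   [lower_semicontinuous]. *)
Definition enorm (R : realType) (p : nat) (u : 'rV[R]_p) : R :=
  Num.sqrt (\sum_(i < p) u 0 i ^+ 2).

Definition grad (R : realType) (p : nat) (f : 'rV[R]_p -> R) (x : 'rV[R]_p) :
    'rV[R]_p :=
  \row_(i < p) 'D_(delta_mx 0 i) f x.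

Definition smooth (R : realType) (p : nat) (L : R) (f : 'rV[R]_p -> R) : Prop :=
  (forall x, differentiable f x) /\
  forall x y, enorm (grad f x - grad f y) <= L * enorm (x - y).

Definition strongly_convex (R : realType) (p : nat) (mu : R)
    (f : 'rV[R]_p -> R) : Prop :=
  forall (x y : 'rV[R]_p) (t : R), 0 <= t <= 1 ->
    f (t *: x + (1 - t) *: y) <=
      t * f x + (1 - t) * f y - mu / 2 * (t * (1 - t)) * enorm (x - y) ^+ 2.

Definition proper (R : realType) (p : nat) (psi : 'rV[R]_p -> \bar R) : Prop :=
  (forall x, psi x != -oo%E) /\ exists x, (psi x < +oo)%E.

(* On functions avoiding -oo no indeterminate sum can occur, and 0 * +oo = 0
   makes the endpoints t = 0 and t = 1 trivial. *)
Definition econvex (R : realType) (p : nat) (psi : 'rV[R]_p -> \bar R) : Prop :=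
  forall (x y : 'rV[R]_p) (t : R), 0 <= t <= 1 ->
    (psi (t *: x + (1 - t) *: y)%R <= t%:E * psi x + (1 - t)%:E * psi y)%E.

Definition objective (R : realType) (p : nat) (f : 'rV[R]_p -> R)
    (psi : 'rV[R]_p -> \bar R) (x : 'rV[R]_p) : \bar R :=
  ((f x)%:E + psi x)%E.

Definition minimizer (R : realType) (p : nat) (F : 'rV[R]_p -> \bar R)
    (xs : 'rV[R]_p) : Prop :=
  forall z, (F xs <= F z)%E.

(* [x = Prox_(eta psi)[u]], as a relation: the argmin is unique when [psi] is
   proper, convex and lower semicontinuous and [eta > 0]. *)
Definition is_prox (R : realType) (p : nat) (eta : R)
    (psi : 'rV[R]_p -> \bar R) (u x : 'rV[R]_p) : Prop :=
  minimizer (fun z => eta%:E * psi z + (2^-1 * enorm (z - u) ^+ 2)%:E)%E x.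

Record composite_problem (R : realType) (p : nat) (L mu : R)
    (f : 'rV[R]_p -> R) (psi : 'rV[R]_p -> \bar R) : Prop := {
  cp_L_gt0 : 0 < L;
  cp_convex : convex_function setT f;
  cp_smooth : smooth L f;
  cp_strong : strongly_convex mu f;
  cp_proper : proper psi;
  cp_econvex : econvex psi;
  cp_lsc : lower_semicontinuous psi
}.

(* Sub-sigma-algebras are given by their sets; [X] is Borel measurable with
   respect to [G]. *)
Definition measurable_wrt (T : Type) (S : topologicalType) (G : set (set T))
    (X : T -> S) : Prop :=
  forall B : set S, <<s @open S >> B -> G (X @^-1` B).

Definition filtration (d : measure_display) (T : measurableType d)
    (Fl : nat -> set (set T)) : Prop :=
  [/\ forall k, sigma_algebra setT (Fl k),
      forall k, Fl k `<=` measurable &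
      forall k, Fl k `<=` Fl k.+1].

(* [E[X | G] = Z] (as a version), for random vectors. *)
Definition is_cond_exp (d : measure_display) (T : measurableType d)
    (R : realType) (P : probability T R) (p : nat) (G : set (set T))
    (X Z : T -> 'rV[R]_p) : Prop :=
  measurable_wrt G Z /\
  forall i : 'I_p,
    [/\ P.-integrable setT (fun w => (X w 0 i)%:E),
        P.-integrable setT (fun w => (Z w 0 i)%:E) &
        forall A, G A ->
          (\int[P]_(w in A) (X w 0 i)%:E = \int[P]_(w in A) (Z w 0 i)%:E)%E].

Record step_parameters (R : realType) (L mu : R) (eta gamma delta : nat -> R) :
    Prop := {
  sp_eta : forall k, 0 < eta k <= 1 / L;
  sp_gamma0_ge : mu <= gamma 0%N;
  sp_gamma0_gt0 : 0 < gamma 0%N;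
  sp_delta : forall k, delta k = Num.sqrt (eta k * gamma k);
  sp_gamma : forall k,
    gamma k.+1 = (1 - delta k.+1) * gamma k + delta k.+1 * mu
}.

Definition beta (R : realType) (eta delta : nat -> R) (k : nat) : R :=
  delta k * (1 - delta k) * eta k.+1 /
    (eta k * delta k.+1 + eta k.+1 * delta k ^+ 2).

(* [Fl k] is the information available after [k] iterations. The gradient
   estimates are [g 1, g 2, ...]; [g 0] is never used. The starting point
   [x 0] may be random. *)
Record algorithmC (d : measure_display) (T : measurableType d) (R : realType)
    (P : probability T R) (p : nat) (L mu : R) (f : 'rV[R]_p -> R)
    (psi : 'rV[R]_p -> \bar R) (eta gamma delta : nat -> R)
    (Fl : nat -> set (set T)) (x y g : nat -> T -> 'rV[R]_p) : Prop := {
  ac_parameters : step_parameters L mu eta gamma delta;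
  ac_filtration : filtration Fl;
  ac_x_adapted : forall k, measurable_wrt (Fl k) (x k);
  ac_y_adapted : forall k, measurable_wrt (Fl k) (y k);
  ac_g_adapted : forall k, measurable_wrt (Fl k.+1) (g k.+1);
  ac_y0 : forall w, y 0%N w = x 0%N w;
  ac_unbiased : forall k,
    is_cond_exp P (Fl k) (g k.+1) (fun w => grad f (y k w));
  ac_x : forall k w,
    is_prox (eta k.+1) psi (y k w - eta k.+1 *: g k.+1 w) (x k.+1 w);
  ac_y : forall k w,
    y k.+1 w = x k.+1 w + beta eta delta k.+1 *: (x k.+1 w - x k w)
}.

(* Meaningful for [k >= 1]. *)
Definition omega2 (d : measure_display) (T : measurableType d) (R : realType)
    (P : probability T R) (p : nat) (f : 'rV[R]_p -> R)
    (y g : nat -> T -> 'rV[R]_p) (k : nat) : \bar R :=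
  'E_P[fun w => (enorm (grad f (y k.-1 w) - g k w) ^+ 2)%R]%E.

(* [E[F(X) - F(xs)]]; extended-real valued since [F] is. *)
Definition expected_gap (d : measure_display) (T : measurableType d)
    (R : realType) (P : probability T R) (p : nat) (F : 'rV[R]_p -> \bar R)
    (xs : 'rV[R]_p) (X : T -> 'rV[R]_p) : \bar R :=
  (\int[P]_w (F (X w) - F xs))%E.

Definition eta_decreasing (R : realType) (L mu : R) (k : nat) : R :=
  Num.min (1 / L) (4 / (mu * (k%:R + 2) ^+ 2)).

(* [max (log z, 0)], equal to +oo at +oo. *)
Definition log_plus (R : realType) (z : \bar R) : \bar R := maxe (lne z) 0%E.

(* Main.v *)
Require Import Defs.
From HB Require Import structures.
From mathcomp Require Import all_boot all_order all_algebra.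
From mathcomp Require Import all_classical all_reals all_analysis.
From mathcomp Require Import measurable_realfun ring lra.

(** With [gamma_0 = mu] all [gamma_k] equal [mu] and [eta_k = delta_k^2 / mu].
    Put [v_0 = x_0] and [v_k = x_{k-1} + (x_k - x_{k-1}) / delta_k]; the momentum
    rule says exactly that [(1 + delta_{k+1}) y_k = x_k + delta_{k+1} v_k].  The
    Lyapunov function [V_k = F(x_k) - F* + mu/2 |v_k - x*|^2] satisfies
    [E V_{k+1} <= (1 - delta_{k+1}) E V_k + eta_{k+1} sigma^2]: compare
    the proximal step with the test point [z = (1 - delta) x_k + delta x*], and
    replace the new iterate in the noise term by the noiseless proximal point,
    which is measurable with respect to the past and, by nonexpansiveness, at
    distance at most [eta |g - grad f|].

    With [delta = sqrt (mu / L)] the recursion gives geometric convergence to the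
    noise level [sigma^2 / sqrt (mu L)].  With [delta_k = min (sqrt (mu / L), 2 / (k + 2))]
    it preserves [E V_k <= 4 (sigma^2 / mu) delta_k], which is at most
    [8 sigma^2 / (mu (k + 2))].  Since [eps < 2 sigma^2 / sqrt (mu L)], both
    [sqrt (L / mu)] and [1] are at most [2 sigma^2 / (mu eps)], so additive
    constants are absorbed in the second term of the bound. *)

Set Implicit Arguments.
Unset Strict Implicit.
Unset Printing Implicit Defensive.

Import Order.TTheory GRing.Theory Num.Theory.
Import numFieldNormedType.Exports.

Local Open Scope classical_set_scope.
Local Open Scope ring_scope.

(** * Euclidean inner product and gradient inequalities *)

Section Euclid.
Context {R : realType} {p : nat}.
Implicit Types u v w : 'rV[R]_p.

Definition dot u v : R := \sum_(i < p) u 0 i * v 0 i.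

Lemma dotC u v : dot u v = dot v u.
Proof. by apply: eq_bigr => i _; rewrite mulrC. Qed.

Lemma dotDl u v w : dot (u + v) w = dot u w + dot v w.
Proof. by rewrite -big_split; apply: eq_bigr => i _; rewrite !mxE mulrDl. Qed.

Lemma dotZl a u v : dot (a *: u) v = a * dot u v.
Proof. by rewrite mulr_sumr; apply: eq_bigr => i _; rewrite !mxE mulrA. Qed.

Lemma dotNl u v : dot (- u) v = - dot u v.
Proof. by rewrite -scaleN1r dotZl mulN1r. Qed.

Lemma dotDr u v w : dot w (u + v) = dot w u + dot w v.
Proof. by rewrite dotC dotDl !(dotC w). Qed.

Lemma dotZr a u v : dot v (a *: u) = a * dot v u.
Proof. by rewrite dotC dotZl (dotC v). Qed.

Lemma dotNr u v : dot v (- u) = - dot v u.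
Proof. by rewrite dotC dotNl (dotC v). Qed.

Lemma dot0l u : dot 0 u = 0.
Proof. by rewrite -(scale0r 0) dotZl mul0r. Qed.

Lemma dot_ge0 u : 0 <= dot u u.
Proof. by apply: sumr_ge0 => i _; rewrite -expr2 sqr_ge0. Qed.

Definition dotE := (dotDl, dotDr, dotZl, dotZr, dotNl, dotNr).

Lemma enorm_sqr u : enorm u ^+ 2 = dot u u.
Proof.
rewrite /enorm sqr_sqrtr; last by apply: sumr_ge0 => i _; exact: sqr_ge0.
by apply: eq_bigr => i _; rewrite expr2.
Qed.

Lemma enorm_ge0 u : 0 <= enorm u. Proof. exact: sqrtr_ge0. Qed.

Lemma dot_sqr_coord u i : u 0 i ^+ 2 <= dot u u.
Proof.
rewrite /dot (bigD1 i) //= -expr2 lerDl; apply: sumr_ge0 => j _.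
by rewrite -expr2 sqr_ge0.
Qed.

Lemma dot_eq0 u : dot u u = 0 -> u = 0.
Proof.
move=> u0; apply/rowP => i; rewrite mxE; apply/eqP.
by rewrite -sqrf_eq0 eq_le sqr_ge0 andbT -u0 dot_sqr_coord.
Qed.

(* [0 <= |a u - b v|^2] with [a = |v|], [b = |u|] *)
Lemma cauchy_schwarz u v : dot u v <= enorm u * enorm v.
Proof.
have [u0|u0] := eqVneq (enorm u) 0.
  have /dot_eq0 -> : dot u u = 0 by rewrite -enorm_sqr u0 expr0n.
  by rewrite dot0l mulr_ge0 ?enorm_ge0.
have [v0|v0] := eqVneq (enorm v) 0.
  have /dot_eq0 -> : dot v v = 0 by rewrite -enorm_sqr v0 expr0n.
  by rewrite dotC dot0l mulr_ge0 ?enorm_ge0.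
have := dot_ge0 (enorm v *: u - enorm u *: v).
rewrite !dotE -!enorm_sqr (dotC v u).
have : 0 < enorm u * enorm v by rewrite mulr_gt0 // lt0r enorm_ge0 ?u0 ?v0.
set a := enorm u; set b := enorm v; set d := dot u v => ab.
rewrite (_ : _ + _ = 2 * (a * b) * (a * b - d)); last ring.
by rewrite pmulr_rge0 ?subr_ge0 // mulr_gt0.
Qed.

(** Expand [0 <= |c u - v|^2] and divide by [2 * c]. *)
Lemma young c u v : 0 < c -> dot u v <= c / 2 * dot u u + (2 * c)^-1 * dot v v.
Proof.
move=> c0; have := dot_ge0 (c *: u - v); rewrite !dotE (dotC v u) => H.
rewrite -(ler_pM2l (_ : 0 < 2 * c)) ?mulr_gt0 // mulrDr.
rewrite [X in _ + X]mulrA mulfV ?mul1r ?mulf_neq0 ?gt_eqF //.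
by lra.
Qed.

Lemma dot_addsqr u v : dot (u + v) (u + v) <= 2 * dot u u + 2 * dot v v.
Proof. by have := dot_ge0 (u - v); rewrite !dotE (dotC v u); lra. Qed.

Lemma dot_subsqr u v : dot (u - v) (u - v) <= 2 * dot u u + 2 * dot v v.
Proof. by have := dot_ge0 (u + v); rewrite !dotE (dotC v u); lra. Qed.

Lemma dot_le_enorm u v c : 0 <= c -> enorm u <= c * enorm v ->
  dot u u <= c ^+ 2 * dot v v.
Proof.
by move=> c0; rewrite -!enorm_sqr -exprMn ler_pXn2r ?nnegrE ?mulr_ge0 ?enorm_ge0.
Qed.

(** The last term is the source of the quadratic gain in [prox_strong] and of the midpoint gain in
    [prox_exists]. *)
Lemma dot_convex_comb t u v w :
  dot (t *: u + (1 - t) *: v - w) (t *: u + (1 - t) *: v - w) =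
  t * dot (u - w) (u - w) + (1 - t) * dot (v - w) (v - w)
  - t * (1 - t) * dot (u - v) (u - v).
Proof.
rewrite !dotE (dotC v u) (dotC w u) (dotC w v); ring.
Qed.

End Euclid.

Lemma le_limit0 {R : realType} (a b c : R) :
  (forall t, 0 < t < 1 -> a <= b + t * c) -> a <= b.
Proof.
move=> H; rewrite leNgt; apply/negP => ab.
(* Chosen so that [0 < e < 1] and [e * c < a - b], whatever the sign and size of [c]. *)
pose e := (a - b) / (2 * (1 + `|c| + (a - b))).
have d0 : 0 < 1 + `|c| + (a - b) by rewrite ltr_wpDl ?subr_gt0 // addr_ge0.
have e01 : 0 < e < 1.
  rewrite divr_gt0 ?subr_gt0 ?mulr_gt0 //= ltr_pdivrMr ?mulr_gt0 // mul1r.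
  by have := normr_ge0 c; lra.
have := H _ e01; apply/negP; rewrite -ltNge.
have -> : a = b + (a - b) by ring.
rewrite ltrD2l /e mulrAC ltr_pdivrMr ?mulr_gt0 //.
rewrite ltr_pM2l ?subr_gt0 //; have := ler_norm c; have := normr_ge0 c; lra.
Qed.

Section Gradient.
Context {R : realType} {p : nat}.
Variables (f : 'rV[R]_p -> R).
Implicit Types u v x y : 'rV[R]_p.

Lemma derive_grad x v : differentiable f x -> 'D_v f x = dot (grad f x) v.
Proof.
move=> df; rewrite deriveE // {1}(row_sum_delta v) linear_sum /=.
by apply: eq_bigr => i _; rewrite linearZ /= mxE deriveE // mulrC.
Qed.

(** Chain rule: the difference quotient of [s |-> x + s v] equals [v] for every nonzero
    increment. *)
Lemma is_derive_line x v (t : R) : differentiable f (x + t *: v) ->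
  is_derive t 1 (fun s : R => f (x + s *: v)) (dot (grad f (x + t *: v)) v).
Proof.
move=> df.
have dl : is_derive t 1 (fun s : R => x + s *: v) v.
  apply: DeriveDef; last first.
    rewrite /derive; apply: cvg_lim => //; apply: cvg_near_cst.
    near=> h => /=.
    rewrite opprD addrACA subrr add0r -scalerBl addrK scalerA.
    have h0 : h != 0 by near: h; exact: nbhs_dnbhs_neq.
    by rewrite [h%:A]mulr1 mulVf // scale1r.
  apply: (is_cvg_near_cst v); near=> h => /=.
  rewrite opprD addrACA subrr add0r -scalerBl addrK scalerA.
  have h0 : h != 0 by near: h; exact: nbhs_dnbhs_neq.
  by rewrite [h%:A]mulr1 mulVf // scale1r.
have ddl : differentiable (fun s : R => x + s *: v) t.
  by apply/derivable1_diffP; case: dl.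
have dc : differentiable (f \o (fun s : R => x + s *: v)) t.
  exact: differentiable_comp.
apply: DeriveDef; first exact/derivable1_diffP.
rewrite deriveE // [X in 'd X _](_ : _ = f \o (fun s : R => x + s *: v)) //.
rewrite diff_comp //=.
have -> : 'd (fun s : R => x + s *: v) t 1 = v by rewrite -deriveE //; case: dl.
by rewrite -deriveE // derive_grad.
Unshelve. all: by end_near. Qed.

(** Along the segment, [h] is [f] minus its linear part and minus [L / 2 * t^2 |v|^2].
    Cauchy-Schwarz and the Lipschitz gradient make [h' <= 0], hence [h 1 <= h 0], with no
    integration. *)
Lemma descent (L : R) x y : smooth L f ->
  f y <= f x + dot (grad f x) (y - x) + L / 2 * dot (y - x) (y - x).
Proof.
move=> [df lf]; set v := y - x.
pose h (t : R) := f (x + t *: v) - t * dot (grad f x) v - t ^+ 2 * (L / 2 * dot v v).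
have dh (t : R) : is_derive t 1 h
    (dot (grad f (x + t *: v)) v - dot (grad f x) v - 2 * t * (L / 2 * dot v v)).
  have -> : h = (fun s : R => f (x + s *: v)) - (dot (grad f x) v) *: (@id R)
       - (L / 2 * dot v v) *: ((@id R) ^+ 2).
    apply/funext => s; rewrite /h.
    by rewrite !fctE /= /GRing.scale /= (mulrC s) (mulrC (s ^+ 2)).
  have D1 := @is_derive_line x v t (df _).
  apply: is_derive_eq.
  by rewrite /GRing.scale /= !mulr1 expr1; ring.
have hle : h 1 <= h 0.
  apply: (@ler0_derive1_le_cc R h 0 1) => //.
  - move=> t; rewrite in_itv /= => /andP[t0 t1].
    rewrite derive1E; case: (dh t) => _ ->.
    have := cauchy_schwarz (grad f (x + t *: v) - grad f x) v.
    have := ler_wpM2r (enorm_ge0 v) (lf (x + t *: v) x).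
    rewrite addrAC subrr add0r.
    have -> : enorm (t *: v) = t * enorm v.
      apply/eqP; rewrite -(eqrXn2 (_ : 0 < 2)%N) ?enorm_ge0 ?mulr_ge0 ?enorm_ge0 ?(ltW t0) //.
      by rewrite exprMn !enorm_sqr !dotE; apply/eqP; ring.
    have -> : L * (t * enorm v) * enorm v = L * t * enorm v ^+ 2 by ring.
    by rewrite enorm_sqr !dotE; lra.
  - apply: continuous_subspaceT => t.
    by apply/differentiable_continuous/derivable1_diffP; case: (dh t).
  - by rewrite in_itv /= lexx ler01.
  - by rewrite in_itv /= lexx ler01.
move: hle; rewrite /h scale1r scale0r addr0 [x + v]addrC subrK; lra.
Qed.

(** Strong convexity between [x] and [y] bounds the slope of [f] over [[x, x + t v]]; let [t] tend
    to [0] from the right. *)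
Lemma strong_convex_grad (mu : R) x y : differentiable f x ->
  strongly_convex mu f ->
  f x + dot (grad f x) (y - x) + mu / 2 * dot (y - x) (y - x) <= f y.
Proof.
move=> df sf; set v := y - x.
have D : is_derive (0 : R) 1 (fun s : R => f (x + s *: v)) (dot (grad f x) v).
  have := @is_derive_line x v 0; rewrite scale0r addr0; exact.
have bound (t : R) : 0 < t < 1 ->
    t^-1 * (f (x + t *: v) - f x) <= f y - f x - mu / 2 * (1 - t) * dot v v.
  move=> /andP[t0 t1].
  have := sf y x t; rewrite (ltW t0) (ltW t1) => /(_ isT).
  have -> : t *: y + (1 - t) *: x = x + t *: v.
    by rewrite /v scalerBl scalerBr scale1r addrC -addrA [- _ + _]addrC.
  rewrite -/v enorm_sqr => H; rewrite ler_pdivrMl //; nra.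
have cv : (fun h : R => h^-1 * (f (x + h *: v) - f x)) @ 0^'+ --> dot (grad f x) v.
  have [c e] := D; rewrite -e.
  apply: cvg_dnbhs_at_right; move: c; rewrite /derivable /derive /=.
  rewrite (_ : (fun h : R => _) = (fun h : R => h^-1 * (f (x + h *: v) - f x))) //.
  by apply/funext => h /=; rewrite scale0r !addr0 [h%:A]mulr1.
have cv2 : (fun t : R => f y - f x - mu / 2 * (1 - t) * dot v v) @ 0^'+ -->
    f y - f x - mu / 2 * (1 - 0) * dot v v.
  apply: cvg_at_right_filter; apply: cvgB; first exact: cvg_cst.
  apply: cvgMr_tmp; apply: cvgMl_tmp; apply: cvgB; [exact: cvg_cst|exact: cvg_id].
have : dot (grad f x) v <= f y - f x - mu / 2 * (1 - 0) * dot v v.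
  apply: (ler_cvg_to cv cv2); near=> t; apply: bound; apply/andP; split => //.
by rewrite subr0; lra.
Unshelve. all: by end_near. Qed.

End Gradient.

(** * Existence of minimizers *)

Section SupNorm.
Context {R : realType} {p : nat}.
Implicit Types u v w : 'rV[R]_p.

Lemma mx_norm_le_enorm u : `|u| <= enorm u.
Proof.
rewrite /Num.Def.normr /= mx_normrE; apply: bigmax_le => [|[i j] _ /=].
  exact: enorm_ge0.
rewrite ord1 -(ler_pXn2r (_ : (0 < 2)%N)) ?nnegrE ?enorm_ge0 //.
by rewrite real_normK ?num_real // enorm_sqr dot_sqr_coord.
Qed.

Lemma coord_le_mx_norm u i : `|u 0 i| <= `|u|.
Proof.
rewrite [leRHS]/Num.Def.normr /= mx_normrE.
exact: (le_bigmax _ (fun ij : 'I_1 * 'I_p => `|u ij.1 ij.2|) (0, i)).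
Qed.

Lemma dot_le_mx_norm u : dot u u <= p%:R * `|u| ^+ 2.
Proof.
rewrite mulr_natl -[X in _ *+ X]card_ord -sumr_const; apply: ler_sum => i _.
rewrite -expr2 -[leLHS]real_normK ?num_real //.
by rewrite ler_pXn2r ?nnegrE // coord_le_mx_norm.
Qed.

(** The topology comes from the sup norm and the hypothesis is Euclidean, so the two norms are
    compared, at the price of a factor [p]. *)
Lemma lipschitz_enorm_continuous (c : R) (h : 'rV[R]_p -> 'rV[R]_p) :
  (forall u v, dot (h u - h v) (h u - h v) <= c * dot (u - v) (u - v)) ->
  continuous h.
Proof.
move=> H u; apply/(@cvgrPdist_lt _ _ _ (nbhs u)) => e e0.
(* The summand [1] keeps [k] positive even when [c] or [p] is zero. *)
pose k := 1 + `|c| * p%:R.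
have k0 : 0 < k by rewrite ltr_wpDr // mulr_ge0.
have d0 : 0 < e / Num.sqrt k by rewrite divr_gt0 // sqrtr_gt0.
near=> v; apply: le_lt_trans (mx_norm_le_enorm _) _.
rewrite -(ltr_pXn2r (_ : (0 < 2)%N)) ?nnegrE ?enorm_ge0 ?(ltW e0) //.
rewrite enorm_sqr; apply: le_lt_trans (H _ _) _.
apply: (@le_lt_trans _ _ (k * `|u - v| ^+ 2)).
  apply: (@le_trans _ _ (`|c| * dot (u - v) (u - v))).
    by apply: ler_wpM2r; [exact: dot_ge0|exact: ler_norm].
  apply: (@le_trans _ _ (`|c| * (p%:R * `|u - v| ^+ 2))).
    by apply: ler_wpM2l => //; exact: dot_le_mx_norm.
  by rewrite mulrA; apply: ler_wpM2r; rewrite ?sqr_ge0 // /k lerDr.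
have : `|u - v| < e / Num.sqrt k.
  by near: v; exact: (@cvgr_dist_lt _ _ _ _ _ id u (@cvg_id _ (nbhs u)) _ d0).
rewrite -(ltr_pXn2r (_ : (0 < 2)%N)) ?nnegrE ?(ltW d0) // exprMn exprVn.
by rewrite sqr_sqrtr ?(ltW k0) // ltr_pdivlMr // mulrC.
Unshelve. all: by end_near. Qed.

Lemma continuous_dot_sub u : continuous (fun z : 'rV[R]_p => dot (z - u) (z - u)).
Proof.
apply: continuous_big => [|i _ z]; first exact: add_continuous.
have H : (fun w : 'rV[R]_p => (w - u) 0 i) @ z --> (z - u) 0 i.
  rewrite (_ : (fun w => _) = (fun w : 'rV[R]_p => w 0 i - u 0 i)); last first.
    by apply/funext => w; rewrite !mxE.
  rewrite !mxE; apply: (@cvgB _ _ _ (nbhs z)).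
    exact: (@coord_continuous R 1 p 0 i z).
  exact: cvg_cst.
exact: (@cvgM _ _ (nbhs z)).
Qed.

End SupNorm.

Section Argmin.
Context {R : realType} {p : nat}.
Local Open Scope ereal_scope.
Implicit Types x z : 'rV[R]_p.

Lemma lower_semicontinuous_affine (psi : 'rV[R]_p -> \bar R) (q : 'rV[R]_p -> R) (eta : R) :
  (0 < eta)%R -> lower_semicontinuous psi -> continuous q ->
  (forall z, psi z != -oo) ->
  lower_semicontinuous (fun z => eta%:E * psi z + (q z)%:E).
Proof.
move=> e0 lp cq pN x a ax.
(* The slack in [a < eta * psi x + q x] is shared between the two summands: half each when [psi x]
   is finite, any large enough [b] when it is infinite. *)
have [b [bx ab]] : exists b : R, b%:E < psi x /\ (a - eta * b < q x)%R.
  move: ax (pN x); case: (psi x) => [r| |] //.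
    rewrite -EFinM -EFinD lte_fin => ar _.
    exists (r - (eta * r + q x - a) / (2 * eta))%R; split.
      rewrite lte_fin ltrBlDr ltrDl divr_gt0 ?mulr_gt0 //; lra.
    have -> : (eta * (r - (eta * r + q x - a) / (2 * eta)) =
       eta * r - (eta * r + q x - a) / 2)%R by field; rewrite gt_eqF.
    lra.
  move=> _ _; exists ((a - q x + 1) / eta)%R; split; first exact: ltry.
  by rewrite mulrC divfK ?gt_eqF //; lra.
have [V nV HV] := lp x b bx.
exists (V `&` [set y | (a - eta * b < q y)%R]).
  apply: filterI => //; exact: (cvgr_gt _ (cq x) _ ab).
move=> y [Vy /= qy]; have := HV y Vy.
case: (psi y) => [r|_|//]; last by rewrite gt0_muley ?lte_fin // addye // ltry.
rewrite lte_fin => br; rewrite -EFinM -EFinD lte_fin.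
by rewrite -(ltr_pM2l e0) in br; lra.
Qed.

(** Completeness replaces compactness. By the midpoint gain, two points with values at most
    [inf + e] satisfy [c |x - z|^2 <= e]; the near-minimal sets thus generate a Cauchy filter, and
    lower semicontinuity makes its limit a minimizer. *)
Lemma strongly_midconvex_argmin (h : 'rV[R]_p -> \bar R) (m c : R) :
  (0 < c)%R -> lower_semicontinuous h -> (forall z, m%:E <= h z) ->
  (exists z, h z < +oo) ->
  (forall x z (a b : R), h x <= a%:E -> h z <= b%:E ->
     h (2^-1 *: x + 2^-1 *: z)%R <= (2^-1 * (a + b) - c * dot (x - z) (x - z))%:E) ->
  exists x, minimizer h x.
Proof.
move=> c0 lh hm [z0 hz0] hmid.
have hreal z : h z < +oo -> exists r : R, h z = r%:E /\ (m <= r)%R.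
  by have := hm z; case: (h z) => [r| |] // mr _; exists r.
pose S := [set r : R | exists z, h z = r%:E].
have Sinf : has_inf S.
  split; first by have [r [hr _]] := hreal _ hz0; exists r, z0.
  by exists m => r [z hz]; have := hm z; rewrite hz lee_fin.
set I := inf S.
have Ile z : I%:E <= h z.
  have [hz|] := ltP (h z) +oo; last by rewrite leye_eq => /eqP ->; rewrite leey.
  have [r [hr _]] := hreal _ hz; rewrite hr lee_fin.
  by apply: ge_inf; [case: Sinf|exists z].
pose B (e : R) := [set z | h z <= (I + e)%:E].
pose F := filter_from [set e : R | 0 < e]%R B.
have FF : ProperFilter F.
  apply: filter_from_proper; first apply: filter_from_filter.
  - by exists 1%R => /=.
  - move=> i j /= i0 j0; exists (Num.min i j); first by rewrite /= lt_min i0 j0.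
    by move=> z /= Bz; split; apply: le_trans Bz _;
      rewrite lee_fin lerD2l ge_min lexx ?orbT.
  - move=> e /= e0; have [r [z hz] re] := inf_adherent e0 Sinf.
    by exists z; rewrite /B /= hz lee_fin ltW.
have cF : cauchy F.
  apply: cauchy_exP => e e0.
  (* The midpoint inequality gives [c |z - w|^2 <= d], which is below [c e^2]. *)
  pose d := (c * e ^+ 2 / 2)%R.
  have d0 : (0 < d)%R by rewrite divr_gt0 // mulr_gt0 // exprn_gt0.
  have [r [z hz] rd] := inf_adherent d0 Sinf.
  exists z; exists d => // w /= Bw.
  rewrite -ball_normE /=; apply: le_lt_trans (mx_norm_le_enorm _) _.
  rewrite -(ltr_pXn2r (_ : (0 < 2)%N)) ?nnegrE ?enorm_ge0 ?(ltW e0) // enorm_sqr.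
  have Bz : h z <= (I + d)%:E by rewrite hz lee_fin ltW.
  have := le_trans (Ile _) (hmid _ _ _ _ Bz Bw); rewrite lee_fin => H.
  rewrite -(ltr_pM2l c0); move: d0; rewrite /d in H *; lra.
have Fx : F --> lim F by exact: cauchy_cvg.
exists (lim F) => z; apply: le_trans _ (Ile z); rewrite leNgt; apply/negP => Ih.
(* If the limit were not minimal, [h] would exceed some [a > I] near it, but points with values
   arbitrarily close to [I] lie there. *)
have [a [Ia ah]] : exists a : R, (I < a)%R /\ a%:E < h (lim F).
  move: Ih; case: (h (lim F)) => [r| |] //; rewrite ?lte_fin.
    by move=> Ir; exists ((I + r) / 2)%R; rewrite lte_fin; split; lra.
  by move=> _; exists (I + 1)%R; split; [lra|exact: ltry].
have [V nV HV] := lh _ _ ah.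
have [e /= e0 BV] := Fx _ nV.
have me : (0 < Num.min e (a - I))%R by rewrite lt_min e0 subr_gt0.
have [r [w hw] rd] := inf_adherent me Sinf.
have : a%:E < h w.
  apply/HV/BV; rewrite /B /= hw lee_fin; apply: le_trans (ltW rd) _.
  by rewrite lerD2l ge_min lexx.
rewrite hw lte_fin => ar; move: rd; rewrite -/I.
have : (Num.min e (a - I) <= a - I)%R by rewrite ge_min lexx orbT.
lra.
Qed.

End Argmin.

(** * Deterministic proximal gradient analysis *)

Section Prox.
Context {R : realType} {p : nat} {psi : 'rV[R]_p -> \bar R}.
Hypotheses (psi_proper : Defs.proper psi) (psi_econvex : econvex psi).
Implicit Types u x z : 'rV[R]_p.

Lemma proper_EFin z : (psi z < +oo)%E -> exists r : R, psi z = r%:E.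
Proof. by have [/(_ z)] := psi_proper; case: (psi z) => [r| |] // _ _ _; exists r. Qed.

(** An infinite [psi x] would make the prox objective infinite at its minimizer, while properness
    provides a point where it is finite. *)
Lemma prox_EFin (eta : R) u x : 0 < eta -> is_prox eta psi u x ->
  exists r : R, psi x = r%:E.
Proof.
move=> e0 px; apply: proper_EFin.
have [pN [z0 /proper_EFin[r hr]]] := psi_proper.
have := px z0; rewrite hr -EFinM -EFinD; move: (pN x).
case: (psi x) => [s| |] //; first by rewrite ltry.
by rewrite gt0_muley ?lte_fin // addye.
Qed.

(* The prox objective is 1-strongly convex, so it grows quadratically away from
   its minimizer. *)
Lemma prox_strong (eta r s : R) u x z : 0 < eta -> is_prox eta psi u x ->
  psi x = r%:E -> psi z = s%:E ->
  eta * r + 2^-1 * dot (x - u) (x - u) + 2^-1 * dot (z - x) (z - x) <=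
  eta * s + 2^-1 * dot (z - u) (z - u).
Proof.
move=> e0 px xr zs; apply: (@le_limit0 _ _ _ (2^-1 * dot (z - x) (z - x))) => t /andP[t0 t1].
have := px (t *: z + (1 - t) *: x).
have := @psi_econvex z x t; rewrite (ltW t0) (ltW t1) => /(_ isT).
rewrite xr zs -!EFinM -!EFinD !enorm_sqr.
case: (psi (t *: z + (1 - t) *: x)) (psi_proper.1 (t *: z + (1 - t) *: x)) => [q _| |] //.
rewrite -!EFinM -!EFinD !lee_fin dot_convex_comb => H1 H2.
have H3 : eta * q <= eta * (t * s + (1 - t) * r) by rewrite ler_pM2l.
rewrite -(ler_pM2l t0); lra.
Qed.

(** Testing each minimizer against the other in [prox_strong] and adding gives
    [|x - x'|^2 <= dot (x - x') (u - u')]; the square of [(x - x') - (u - u')] finishes. *)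
Lemma prox_nonexpansive (eta : R) u u' x x' : 0 < eta ->
  is_prox eta psi u x -> is_prox eta psi u' x' ->
  dot (x - x') (x - x') <= dot (u - u') (u - u').
Proof.
move=> e0 px px'.
have [r hr] := prox_EFin e0 px; have [s hs] := prox_EFin e0 px'.
have := prox_strong e0 px hr hs; have := prox_strong e0 px' hs hr.
have := dot_ge0 ((x - x') - (u - u')).
rewrite !dotE (dotC x' x) (dotC u x) (dotC u x') (dotC u' x) (dotC u' x') (dotC u' u); lra.
Qed.

End Prox.

(** * Gap, Lyapunov function and one-step inequalities *)

Definition gap (R : realType) (p : nat) (f : 'rV[R]_p -> R)
    (psi : 'rV[R]_p -> \bar R) (xs x : 'rV[R]_p) : \bar R :=
  (objective f psi x - objective f psi xs)%E.

Definition lyap (R : realType) (p : nat) (mu : R) (f : 'rV[R]_p -> R)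
    (psi : 'rV[R]_p -> \bar R) (xs x v : 'rV[R]_p) : \bar R :=
  (gap f psi xs x + (mu / 2 * dot (v - xs) (v - xs))%:E)%E.

Section Composite.
Context {R : realType} {p : nat} {L mu : R} {f : 'rV[R]_p -> R}
  {psi : 'rV[R]_p -> \bar R} {xs : 'rV[R]_p}.
Hypotheses (cp : composite_problem L mu f psi) (mu0 : 0 < mu)
  (xsmin : minimizer (objective f psi) xs).
Implicit Types u v w x y z g : 'rV[R]_p.

Let L0 : 0 < L := cp_L_gt0 cp.
Let pp := cp_proper cp.
Let pc := cp_econvex cp.

Lemma minimizer_EFin : exists r : R, psi xs = r%:E.
Proof.
apply: (proper_EFin pp); have [pN [z0 hz]] := pp.
have [r hr] := proper_EFin pp hz.
have := xsmin z0; rewrite /objective hr -EFinD.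
by case: (psi xs) => [q| |] //; rewrite ltry.
Qed.

(** The iteration supplies proximal points for the noisy gradients only; the Lyapunov step also
    compares with the one for the exact gradient. *)
Lemma prox_exists (eta : R) y : 0 < eta <= 1 / L ->
  exists x, is_prox eta psi (y - eta *: grad f y) x.
Proof.
move=> /andP[e0 eL]; set u := y - _.
have eL1 : eta * L <= 1 by rewrite -ler_pdivlMr.
have [s hs] := minimizer_EFin.
(* Lower bound: minimality of [xs] gives [psi z >= F* - f z], and [descent] from [y] bounds [f z],
   its quadratic term being absorbed since [eta * L <= 1]. The gain [1/8] is [1/2] times the [1/4]
   of a midpoint. *)
apply: (@strongly_midconvex_argmin _ _ _ (eta * (f xs + s - f y)) 8^-1).
- by rewrite invr_gt0.
- apply: lower_semicontinuous_affine e0 (cp_lsc cp) _ pp.1 => z.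
  rewrite (_ : (fun z => _) = (fun z => 2^-1 * dot (z - u) (z - u))); last first.
    by apply/funext => w; rewrite enorm_sqr.
  apply: (@cvgMl_tmp R 'rV[R]_p (nbhs z)); exact: (@continuous_dot_sub _ _ u z).
- move=> z /=; have [hz|] := ltP (psi z) +oo%E; last first.
    by rewrite leye_eq => /eqP ->; rewrite gt0_muley ?lte_fin // addye // leey.
  have [r hr] := proper_EFin pp hz.
  have := xsmin z; rewrite /objective hr hs -EFinM -!EFinD !lee_fin => H1.
  have H2 := descent y z (cp_smooth cp).
  have H3 : eta * (f xs + s) <= eta * (f z + r) by rewrite ler_pM2l.
  have H4 : eta * f z <= eta * (f y + dot (grad f y) (z - y) + L / 2 * dot (z - y) (z - y)).
    by rewrite ler_pM2l.
  have H5 : eta * L * dot (z - y) (z - y) <= 1 * dot (z - y) (z - y).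
    by rewrite ler_wpM2r // dot_ge0.
  have H6 : 0 <= eta ^+ 2 * dot (grad f y) (grad f y) by rewrite mulr_ge0 ?sqr_ge0 ?dot_ge0.
  rewrite enorm_sqr (_ : z - u = (z - y) + eta *: grad f y); last first.
    by rewrite /u opprB addrA addrAC.
  move: H4 H5 H6; move: (z - y) => v; rewrite !dotE (dotC v (grad f y)); lra.
- have [_ [z0 /(proper_EFin pp)[r hr]]] := pp.
  by exists z0; rewrite /= hr -EFinM -EFinD ltry.
- move=> x z a b /=.
  have fin w c : (eta%:E * psi w + (2^-1 * enorm (w - u) ^+ 2)%:E <= c%:E)%E ->
      exists2 r : R, psi w = r%:E & eta * r + 2^-1 * dot (w - u) (w - u) <= c.
    rewrite enorm_sqr; case: (psi w) (pp.1 w) => [r _| |] //.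
      by rewrite -EFinM -EFinD lee_fin => ?; exists r.
    by rewrite gt0_muley ?lte_fin // addye.
  move=> /fin[r hr Hr] /fin[q hq Hq].
  have h2 : 1 - 2^-1 = 2^-1 :> R by lra.
  have := @pc x z 2^-1; rewrite hr hq h2 -!EFinM -!EFinD enorm_sqr.
  have -> : 0 <= (2^-1 : R) <= 1 by apply/andP; split; lra.
  move=> /(_ isT); have := dot_convex_comb 2^-1 x z u; rewrite h2 => ->.
  case: (psi _) (pp.1 (2^-1 *: x + 2^-1 *: z)) => [w _| |] //.
  rewrite -EFinM -EFinD !lee_fin => Hw.
  have : eta * w <= eta * (2^-1 * r + 2^-1 * q) by rewrite ler_pM2l.
  lra.
Qed.

(** Three-point inequality: [prox_strong] at the test point [z] combined with [descent] from [y] to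
    [x], where [eta * L <= 1] cancels the quadratic term in [x - y]. *)
Lemma prox_grad_step (eta r s : R) y g x z : 0 < eta <= 1 / L ->
  is_prox eta psi (y - eta *: g) x -> psi x = r%:E -> psi z = s%:E ->
  f x + r <= f y + dot (grad f y) (z - y) + s + dot (g - grad f y) (z - x)
    + (2 * eta)^-1 * (dot (z - y) (z - y) - dot (z - x) (z - x)).
Proof.
move=> /andP[e0 eL] px hr hs.
have eL1 : eta * L <= 1 by rewrite -ler_pdivlMr.
have H1 := prox_strong pp pc e0 px hr hs.
have H2 := descent y x (cp_smooth cp).
have H4 : eta * f x <= eta * (f y + dot (grad f y) (x - y) + L / 2 * dot (x - y) (x - y)).
  by rewrite ler_pM2l.
have H5 : eta * L * dot (x - y) (x - y) <= 1 * dot (x - y) (x - y).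
  by rewrite ler_wpM2r // dot_ge0.
rewrite -(ler_pM2l e0) [leRHS]mulrDr mulrA.
have -> : eta * (2 * eta)^-1 = 2^-1 by field; rewrite gt_eqF.
move: H1 H4 H5.
have -> : x - (y - eta *: g) = (x - y) + eta *: g by rewrite opprB addrA addrAC.
have -> : z - (y - eta *: g) = (z - y) + eta *: g by rewrite opprB addrA addrAC.
have -> : z - x = (z - y) - (x - y) by rewrite opprB addrA subrK.
move: (x - y) (z - y) => X Z.
rewrite !dotE (dotC X g) (dotC Z g) (dotC X Z).
lra.
Qed.

Lemma prox_grad_sub_min (eta r s : R) y g x : 0 < eta <= 1 / L ->
  is_prox eta psi (y - eta *: g) x -> psi x = r%:E -> psi xs = s%:E ->
  (f x + r) - (f xs + s) <= dot (g - grad f y) (xs - x)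
    + (2 * eta)^-1 * (dot (y - xs) (y - xs) - dot (x - xs) (x - xs)).
Proof.
move=> he px hr hs.
have := prox_grad_step he px hr hs.
have := strong_convex_grad xs ((cp_smooth cp).1 y) (cp_strong cp).
have : 0 <= mu / 2 * dot (xs - y) (xs - y) by rewrite mulr_ge0 ?dot_ge0 // divr_ge0 // ltW.
have e z : dot (xs - z) (xs - z) = dot (z - xs) (z - xs).
  by rewrite -opprB dotNl dotNr opprK.
rewrite !e; lra.
Qed.

Lemma objective_ge (r s : R) x : psi x = r%:E -> psi xs = s%:E ->
  f xs + s <= f x + r.
Proof. by move=> hr hs; have := xsmin x; rewrite /objective hr hs -!EFinD lee_fin. Qed.

(** Young's inequality with weight [eta] consumes exactly the term in [|x - xs|^2]. The result
    dominates the gap by noise and [y] alone, for integrability. *)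
Lemma prox_grad_gap (eta r s : R) y g x : 0 < eta <= 1 / L ->
  is_prox eta psi (y - eta *: g) x -> psi x = r%:E -> psi xs = s%:E ->
  (f x + r) - (f xs + s) <=
    eta / 2 * dot (g - grad f y) (g - grad f y) + (2 * eta)^-1 * dot (y - xs) (y - xs).
Proof.
move=> he px hr hs; have := prox_grad_sub_min he px hr hs.
move: he => /andP[e0 _]; have := young (g - grad f y) (xs - x) e0.
have -> : dot (xs - x) (xs - x) = dot (x - xs) (x - xs).
  by rewrite -opprB dotNl dotNr opprK.
lra.
Qed.

(** The weight [2 * eta] in Young's inequality consumes only half of the negative term in
    [|x - xs|^2]; the gap, being nonnegative, is dropped. *)
Lemma prox_grad_dist (eta : R) y g x : 0 < eta <= 1 / L ->
  is_prox eta psi (y - eta *: g) x ->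
  dot (x - xs) (x - xs) <=
    4 * eta ^+ 2 * dot (g - grad f y) (g - grad f y) + 2 * dot (y - xs) (y - xs).
Proof.
move=> he px.
have e0 : 0 < eta by case/andP: he.
have [r hr] := prox_EFin pp e0 px; have [s hs] := minimizer_EFin.
have H := prox_grad_sub_min he px hr hs.
have H1 := objective_ge hr hs.
have e20 : 0 < 2 * eta by rewrite mulr_gt0.
have := young (g - grad f y) (xs - x) e20.
have -> : dot (xs - x) (xs - x) = dot (x - xs) (x - xs).
  by rewrite -opprB dotNl dotNr opprK.
move=> H2.
have H3 : 0 <= 2 * eta / 2 * dot (g - grad f y) (g - grad f y)
   + (2 * (2 * eta))^-1 * dot (x - xs) (x - xs)
   + (2 * eta)^-1 * (dot (y - xs) (y - xs) - dot (x - xs) (x - xs)) by lra.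
have := mulr_ge0 (ltW (mulr_gt0 (ltr0n R 4) e0)) H3.
set A := dot (g - _) _; set B := dot (x - xs) _; set C := dot (y - xs) _.
have -> : 4%:R * eta * (2 * eta / 2 * A + (2 * (2 * eta))^-1 * B + (2 * eta)^-1 * (C - B))
   = 4 * eta ^+ 2 * A + 2 * C - B by field; rewrite gt_eqF.
lra.
Qed.

Lemma gapE (r s : R) x : psi x = r%:E -> psi xs = s%:E ->
  gap f psi xs x = ((f x + r) - (f xs + s))%:E.
Proof. by move=> hr hs; rewrite /gap /objective hr hs -!EFinD. Qed.

Lemma gap_pinfty x : psi x = +oo%E -> gap f psi xs x = +oo%E.
Proof.
have [s hs] := minimizer_EFin.
by move=> hx; rewrite /gap /objective hx hs -EFinD addey // addye.
Qed.

Lemma gap_ge0 x : (0 <= gap f psi xs x)%E.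
Proof.
have [s hs] := minimizer_EFin.
have [hx|] := ltP (psi x) +oo%E; last first.
  by rewrite leye_eq => /eqP /gap_pinfty ->; rewrite leey.
by have [r hr] := proper_EFin pp hx; rewrite (gapE hr hs) lee_fin subr_ge0 (objective_ge hr hs).
Qed.

(** The quadratic lower and upper bounds on [f] are compared at a basis vector, which exists only
    when [p] is positive. *)
Lemma mu_le_L : (0 < p)%N -> mu <= L.
Proof.
move=> p0; pose e : 'rV[R]_p := delta_mx 0 (Ordinal p0).
have := descent 0 e (cp_smooth cp).
have := strong_convex_grad e ((cp_smooth cp).1 0) (cp_strong cp).
rewrite subr0 => H1 H2; have := le_trans H1 H2; rewrite lerD2l.
have e1 : 0 < dot e e.
  apply: (@lt_le_trans _ _ (e 0 (Ordinal p0) ^+ 2)); last exact: dot_sqr_coord.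
  by rewrite mxE !eqxx /= expr1n.
by rewrite ler_pM2r // ler_pM2r // invr_gt0.
Qed.

(* With [z = (1 - de) x + de xs], strong convexity of [f] at [y] pays for the
   quadratic terms of the three-point inequality for the proximal step. *)
Lemma lyapunov_step_real (de eta r r0 s q : R) x v y g xp vp :
  0 < eta <= 1 / L -> 0 < de <= 1 -> mu * eta = de ^+ 2 ->
  (1 + de) *: y = x + de *: v ->
  is_prox eta psi (y - eta *: g) xp ->
  xp = (1 - de) *: x + de *: vp ->
  psi xp = r%:E -> psi xs = s%:E ->
  psi ((1 - de) *: x + de *: xs) = q%:E -> q <= (1 - de) * r0 + de * s ->
  (f xp + r) - (f xs + s) + mu / 2 * dot (vp - xs) (vp - xs) <=
  (1 - de) * ((f x + r0) - (f xs + s) + mu / 2 * dot (v - xs) (v - xs))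
   + dot (g - grad f y) ((1 - de) *: x + de *: xs - xp).
Proof.
move=> he /andP[d0 d1] hde hy px hxp hr hs hq hq2.
have := prox_grad_step he px hr hq.
have Sx := strong_convex_grad x ((cp_smooth cp).1 y) (cp_strong cp).
have Ss := strong_convex_grad xs ((cp_smooth cp).1 y) (cp_strong cp).
have e0 : 0 < eta by case/andP: he.
have -> : (2 * eta)^-1 = mu / (2 * de ^+ 2).
  by rewrite -hde; field; rewrite !gt_eqF.
set a := x - y in Sx *; set b := xs - y in Ss *.
set c := vp - xs.
have -> : (1 - de) *: x + de *: xs - xp = - de *: c.
  by rewrite hxp /c; apply/rowP => i; rewrite !mxE; ring.
have -> : (1 - de) *: x + de *: xs - y = (1 - de) *: a + de *: b.
  by rewrite /a /b; apply/rowP => i; rewrite !mxE; ring.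
(* By the coupling of [x], [y] and [v], every vector is now a combination of [a], [b] and [c]. *)
have -> : v - xs = - de^-1 *: a - b.
  have : v = de^-1 *: ((1 + de) *: y - x).
    by rewrite hy addrC addKr scalerA mulVf ?scale1r // gt_eqF.
  move=> ->; rewrite /a /b; apply/rowP => i; rewrite !mxE.
  by field; rewrite gt_eqF.
clearbody a b c; rewrite !dotE.
set ga := dot (grad f y) a in Sx *; set gb := dot (grad f y) b in Ss *.
rewrite (dotC b a).
set aa := dot a a; set ab := dot a b; set bb := dot b b; set cc := dot c c.
have Sx' : (1 - de) * (f y + ga + mu / 2 * aa) <= (1 - de) * f x.
  by rewrite ler_wpM2l // subr_ge0.
have Ss' : de * (f y + gb + mu / 2 * bb) <= de * f xs by rewrite ler_wpM2l // ltW.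
set zc := dot g c - dot (grad f y) c.
have aa0 : 0 <= aa by exact: dot_ge0.
have P1 : mu / (2 * de ^+ 2) * ((1 - de) * ((1 - de) * aa) +
    de * ((1 - de) * ab) + de * ((1 - de) * ab + de * bb) - - de * (- de * cc))
  = mu / 2 * ((1 - de) * (de^-1 ^+ 2 - de^-1) * aa + 2 * (1 - de) * de^-1 * ab
     + bb - cc).
  by field; rewrite gt_eqF.
rewrite P1; clear P1.
(* After strong convexity is used, the terms in [ab] and [bb] cancel exactly; this nonnegative
   multiple of [aa] is what remains to spare. *)
have P3 : 0 <= mu / 2 * ((1 - de) * (1 + de^-1) * aa).
  apply: mulr_ge0; first by rewrite divr_ge0 // ltW.
  by rewrite mulr_ge0 // mulr_ge0 ?subr_ge0 // addr_ge0 // invr_ge0 ltW.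
move: P3; lra.
Qed.

Lemma lyapunov_step (de eta : R) x v y g xp vp xb :
  0 < eta <= 1 / L -> 0 < de <= 1 -> mu * eta = de ^+ 2 ->
  (1 + de) *: y = x + de *: v ->
  is_prox eta psi (y - eta *: g) xp ->
  is_prox eta psi (y - eta *: grad f y) xb ->
  xp = (1 - de) *: x + de *: vp ->
  (lyap mu f psi xs xp vp <= (1 - de)%:E * lyap mu f psi xs x v +
     (dot (g - grad f y) ((1 - de) *: x + de *: xs - xb)
      + eta * dot (g - grad f y) (g - grad f y))%:E)%E.
Proof.
move=> he hd hde hy px pb hxp.
have e0 : 0 < eta by case/andP: he.
have [r hr] := prox_EFin pp e0 px; have [s hs] := minimizer_EFin.
set ze := g - grad f y; set z := (1 - de) *: x + de *: xs.
(* Young's inequality with weight [eta] and [|xb - xp| <= eta |ze|] contribute [eta / 2 * |ze|^2]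
   each. *)
have noise : dot ze (z - xp) <= dot ze (z - xb) + eta * dot ze ze.
  have -> : z - xp = (z - xb) + (xb - xp) by rewrite addrA subrK.
  rewrite dotDr lerD2l.
  have := young ze (xb - xp) e0.
  have := prox_nonexpansive pp pc e0 pb px.
  have -> : (y - eta *: grad f y) - (y - eta *: g) = eta *: ze.
    by rewrite /ze; apply/rowP => i; rewrite !mxE; ring.
  rewrite dotZl dotZr => H1 H2; apply: le_trans H2 _.
  have H3 : (2 * eta)^-1 * dot (xb - xp) (xb - xp) <= eta / 2 * dot ze ze.
    rewrite ler_pdivrMl ?mulr_gt0 //; apply: le_trans H1 _.
    by rewrite le_eqVlt; apply/orP; left; apply/eqP; field.
  lra.
(* [r0] stands for [psi x] but stays free: for [de = 1] its weight is zero and [psi x] may be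
   infinite. *)
have fin_case (q r0 : R) : psi z = q%:E -> q <= (1 - de) * r0 + de * s ->
    (lyap mu f psi xs xp vp <= ((1 - de) * ((f x + r0) - (f xs + s) + mu / 2 * dot (v - xs) (v - xs))
     + (dot ze (z - xb) + eta * dot ze ze))%:E)%E.
  move=> hq hq2; rewrite /lyap (gapE hr hs) -EFinD lee_fin.
  have := lyapunov_step_real he hd hde hy px hxp hr hs hq hq2.
  by rewrite -/ze -/z; lra.
(* Here the test point is [xs], and the convention [0 * +oo = 0] kills the old Lyapunov value. *)
have [d1|d1] := eqVneq de 1.
  have zE : z = xs by rewrite /z d1 subrr scale0r add0r scale1r.
  have := @fin_case s 0; rewrite zE d1 subrr mul0r mul1r !add0r => /(_ hs (lexx _)).
  by rewrite mul0r mul0e !add0r -zE.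
have [hx|] := ltP (psi x) +oo%E; last first.
  rewrite leye_eq => /eqP hx; rewrite {2}/lyap (gap_pinfty hx) addye // gt0_muley ?addye ?leey // lte_fin subr_gt0.
  by rewrite lt_neqAle d1; case/andP: hd.
have [r0 hr0] := proper_EFin pp hx.
have := @pc x xs (1 - de).
have -> : 0 <= 1 - de <= 1 by move: hd => /andP[d0 d2]; apply/andP; split; lra.
move=> /(_ isT); rewrite (_ : 1 - (1 - de) = de); last by ring.
rewrite -/z hr0 hs -!EFinM -!EFinD => Hz.
have [q hq] : exists q : R, psi z = q%:E.
  by apply: (proper_EFin pp); apply: le_lt_trans Hz _; exact: ltry.
have := fin_case q r0 hq; rewrite hq lee_fin in Hz => /(_ Hz).
have -> : lyap mu f psi xs x v = ((f x + r0) - (f xs + s) + mu / 2 * dot (v - xs) (v - xs))%:E.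
  by rewrite /lyap (gapE hr0 hs) -EFinD.
by rewrite -EFinM -EFinD.
Qed.

(** Combine minimality of [xs] with strong convexity on the segment from [xs] to [x], divide by [t]
    and let [t] tend to [0]. *)
Lemma quadratic_growth x : ((mu / 2 * dot (x - xs) (x - xs))%:E <= gap f psi xs x)%E.
Proof.
have [s hs] := minimizer_EFin.
have [hx|] := ltP (psi x) +oo%E; last first.
  by rewrite leye_eq => /eqP /gap_pinfty ->; rewrite leey.
have [r hr] := proper_EFin pp hx; rewrite (gapE hr hs) lee_fin.
apply: (@le_limit0 _ _ _ (mu / 2 * dot (x - xs) (x - xs))) => t /andP[t0 t1].
have t01 : 0 <= t <= 1 by rewrite !ltW.
have := @pc x xs t t01; rewrite hr hs -!EFinM -!EFinD.
have := xsmin (t *: x + (1 - t) *: xs); rewrite /objective hs -EFinD.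
case: (psi _) (pp.1 (t *: x + (1 - t) *: xs)) => [q _| |] //.
rewrite -EFinD !lee_fin => H1 H2.
have := cp_strong cp x xs t01; rewrite enorm_sqr => H3.
rewrite -(ler_pM2l t0); lra.
Qed.

(** Makes the vector paired with the noise square integrable; with the exact gradient, the noise
    term of [prox_grad_dist] vanishes. *)
Lemma prox_grad_test_dist (de eta : R) x y xb : 0 < eta <= 1 / L -> 0 <= de <= 1 ->
  is_prox eta psi (y - eta *: grad f y) xb ->
  dot ((1 - de) *: x + de *: xs - xb) ((1 - de) *: x + de *: xs - xb) <=
    2 * dot (x - xs) (x - xs) + 4 * dot (y - xs) (y - xs).
Proof.
move=> he /andP[d0 d1] pb; have := prox_grad_dist he pb.
rewrite subrr dot0l mulr0 add0r => H.
have -> : (1 - de) *: x + de *: xs - xb = (1 - de) *: (x - xs) - (xb - xs).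
  by apply/rowP => i; rewrite !mxE; ring.
apply: le_trans (dot_subsqr _ _) _; rewrite dotZl dotZr mulrA.
have : (1 - de) * (1 - de) * dot (x - xs) (x - xs) <= 1 * dot (x - xs) (x - xs).
  by rewrite ler_wpM2r ?dot_ge0 //; nra.
lra.
Qed.

(** Continuity will make the noiseless proximal point measurable with respect to the past. The crude
    constant [4] comes from [|a - b|^2 <= 2 |a|^2 + 2 |b|^2] and [eta * L <= 1]. *)
Lemma prox_map_continuous (eta : R) (q : 'rV[R]_p -> 'rV[R]_p) : 0 < eta <= 1 / L ->
  (forall y, is_prox eta psi (y - eta *: grad f y) (q y)) -> continuous q.
Proof.
move=> /andP[e0 eL] hq; apply: (@lipschitz_enorm_continuous _ _ 4) => u v.
have eL1 : eta * L <= 1 by rewrite -ler_pdivlMr.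
apply: le_trans (prox_nonexpansive pp pc e0 (hq u) (hq v)) _.
have -> : (u - eta *: grad f u) - (v - eta *: grad f v) =
    (u - v) - eta *: (grad f u - grad f v).
  by apply/rowP => i; rewrite !mxE; ring.
apply: le_trans (dot_subsqr _ _) _; rewrite dotZl dotZr.
have := dot_le_enorm (ltW L0) ((cp_smooth cp).2 u v).
have : (eta * L) * (eta * L) <= 1.
  by have := mulr_ge0 (ltW e0) (ltW L0); nra.
have := dot_ge0 (u - v); set A := dot (u - v) _; set B := dot (grad f u - _) _.
move=> A0 H1 H2.
have : eta ^+ 2 * B <= eta ^+ 2 * (L ^+ 2 * A) by rewrite ler_wpM2l // sqr_ge0.
have : (eta * L) * (eta * L) * A <= 1 * A by rewrite ler_wpM2r.
lra.
Qed.

End Composite.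

(** * Measurability and conditional expectation *)

Section PullOut.
Context {d : measure_display} {T : measurableType d} {R : realType}
  {P : probability T R} {G : set (set T)}.
Hypotheses (sG : sigma_algebra setT G) (Gm : G `<=` measurable).

Lemma sub_sigma_measurable_fun d' (S : measurableType d') (W : T -> S) :
  measurable_fun (setT : set (g_sigma_algebraType G)) W -> measurable_fun setT W.
Proof.
move=> mW _ A mA; have := mW measurableT A mA.
rewrite /measurable /= sigma_algebra_id // => /Gm; exact.
Qed.

Variable N : T -> R.
Hypothesis iN : P.-integrable setT (EFin \o N).
Hypothesis N0 : forall A, G A -> (\int[P]_(w in A) (N w)%:E = 0)%E.

Let mN : measurable_fun setT N.
Proof. by apply/measurable_EFinP; exact: measurable_int iN. Qed.

Import HBNNSimple.

(** A simple function is a combination of indicators of sets of [G], and [N] integrates to zero on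
    each of them. *)
Lemma integral_mul_nnsfun_eq0 (h : {nnsfun (g_sigma_algebraType G) >-> R}) :
  (\int[P]_w (N w * h w)%:E = 0)%E.
Proof.
pose s := finmap.enum_fset (fset_set (range h)).
have Gh r : G (h @^-1` [set r]).
  have : measurable (h @^-1` [set r]) by [].
  by rewrite /measurable /= sigma_algebra_id.
have E w : (N w * h w)%:E =
    (\sum_(i < size s) (s`_i)%:E * (N w * \1_(h @^-1` [set s`_i]) w)%:E)%E.
  rewrite [X in (N w * X)%:E](fimfunEord h) mulr_sumr -sumEFin.
  by apply: eq_bigr => i _; rewrite -EFinM mulrCA.
under eq_integral do rewrite E.
have iI r : P.-integrable setT (fun w => (N w * \1_(h @^-1` [set r]) w)%:E).
  apply: le_integrable iN => //.
    apply/measurable_EFinP; apply: measurable_funM => //.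
    by apply: measurable_indic; apply: Gm; exact: Gh.
  move=> w _; rewrite /= lee_fin normrM ler_piMr // indicE.
  by case: (_ \in _); rewrite ?normr1 ?normr0.
rewrite integral_sum //; last by move=> i; apply: integrableZl.
apply: big1 => i _; rewrite integralZl //.
rewrite (_ : (\int[P]_w _)%E = 0%E) ?mule0 //.
rewrite -(N0 (Gh (s`_i))) [RHS]integral_mkcond.
apply: eq_integral => w _; rewrite /patch indicE.
by case: (_ \in _); rewrite ?mulr1 ?mulr0.
Qed.

(** Simple functions increase to [W], and [|N W|] dominates the products. *)
Lemma integral_mul_ge0_eq0 (W : T -> R) :
  measurable_fun (setT : set (g_sigma_algebraType G)) W ->
  (forall w, 0 <= W w) -> P.-integrable setT (fun w => (N w * W w)%:E) ->
  (\int[P]_w (N w * W w)%:E = 0)%E.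
Proof.
move=> mW W0 iNW.
have mW' : measurable_fun (setT : set (g_sigma_algebraType G)) (EFin \o W).
  exact/measurable_EFinP.
pose h := nnsfun_approx measurableT mW'.
have W0' w : setT w -> (0 <= (EFin \o W) w)%E by move=> _ /=; rewrite lee_fin.
have hW w n : h n w <= W w.
  by rewrite nnsfun_approxE -lee_fin; apply: le_approx => //; exact: W0'.
have cvg0 : (\int[P]_w (N w * h n w)%:E)%E @[n --> \oo] -->
    (\int[P]_w (N w * W w)%:E)%E.
  apply: (@dominated_cvg _ _ _ P setT measurableT _ _ (fun w => `|(N w * W w)%:E|%E)).
  - move=> n; apply/measurable_EFinP/measurable_funM => //.
    by apply: sub_sigma_measurable_fun.
  - move=> w _.
    have c := @cvg_nnsfun_approx _ _ _ _ measurableT _ mW' W0' w I.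
    rewrite /= EFinM; under eq_fun do rewrite EFinM.
    by apply: cvgeM; [rewrite mule_def_fin | exact: cvg_cst | exact: c].
  - by move=> w _; rewrite abse_fin_num.
  - exact: integrable_abse.
  - move=> n w _; rewrite !abse_EFin lee_fin !normrM ler_wpM2l //.
    by rewrite !ger0_norm // hW.
have cst0 : (fun n => \int[P]_w (N w * h n w)%:E)%E = cst 0%E.
  by apply/funext => n; exact: integral_mul_nnsfun_eq0.
by rewrite -(cvg_lim _ cvg0) // cst0 lim_cst.
Qed.

(** The pull-out property of conditional expectation, obtained by splitting [W] into positive and
    negative parts. *)
Lemma integral_mul_eq0 (W : T -> R) :
  measurable_fun (setT : set (g_sigma_algebraType G)) W ->
  P.-integrable setT (fun w => (N w * W w)%:E) ->
  (\int[P]_w (N w * W w)%:E = 0)%E.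
Proof.
move=> mW iNW.
have mNT : measurable_fun setT (fun w => N w * W w).
  by apply: measurable_funM => //; exact: sub_sigma_measurable_fun.
pose Wp w := Num.max (W w) 0; pose Wn w := Num.max (- W w) 0.
have mp : measurable_fun (setT : set (g_sigma_algebraType G)) Wp.
  by apply: measurable_maxr => //; exact: measurable_cst.
have mn : measurable_fun (setT : set (g_sigma_algebraType G)) Wn.
  by apply: measurable_maxr; [exact: measurableT_comp|exact: measurable_cst].
have bound (V : T -> R) : measurable_fun (setT : set (g_sigma_algebraType G)) V ->
    (forall w, `|V w| <= `|W w|) -> P.-integrable setT (fun w => (N w * V w)%:E).
  move=> mV VW; apply: le_integrable iNW => //.
    apply/measurable_EFinP/measurable_funM => //.
    exact: sub_sigma_measurable_fun.
  by move=> w _; rewrite !abse_EFin lee_fin !normrM ler_wpM2l.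
have ip : P.-integrable setT (fun w => (N w * Wp w)%:E).
  apply: bound => // w; rewrite /Wp; case: (leP (W w) 0) => // _; by rewrite normr0.
have iq : P.-integrable setT (fun w => (N w * Wn w)%:E).
  apply: bound => // w; rewrite /Wn; case: (leP (- W w) 0) => _; by rewrite ?normr0 ?normrN.
have E w : (N w * W w)%:E = ((N w * Wp w)%:E - (N w * Wn w)%:E)%E.
  rewrite -EFinB -mulrBr; congr (_ * _)%:E; rewrite /Wp /Wn.
  by case: (leP (W w) 0); case: (leP (- W w) 0); lra.
under eq_integral do rewrite E.
rewrite integralB // !integral_mul_ge0_eq0 ?sube0 //.
- by move=> w; rewrite /Wn le_max lexx orbT.
- by move=> w; rewrite /Wp le_max lexx orbT.
Qed.

End PullOut.

Section Measurability.
Context {d : measure_display} {T : measurableType d} {R : realType} {p : nat}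
  {G : set (set T)}.
Hypothesis sG : sigma_algebra setT G.

Lemma measurable_wrt_continuous (h : 'rV[R]_p -> R) (X : T -> 'rV[R]_p) :
  measurable_wrt G X -> continuous h ->
  measurable_fun (setT : set (g_sigma_algebraType G)) (fun w => h (X w)).
Proof.
move=> mX /continuousP ch; apply: (measurability _ (RGenOpens.measurableE R)).
move=> _ [_ [a [b ->]] <-]; rewrite setTI.
have oB : open (h @^-1` `]a, b[%classic) by apply: ch; exact: interval_open.
have sB : <<s @open 'rV[R]_p >> (h @^-1` `]a, b[%classic) by exact: sub_sigma_algebra.
by apply: sub_sigma_algebra; exact: (mX _ sB).
Qed.

Lemma measurable_wrt_coord (X : T -> 'rV[R]_p) i : measurable_wrt G X ->
  measurable_fun (setT : set (g_sigma_algebraType G)) (fun w => X w 0 i).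
Proof.
move=> mX; apply: (@measurable_wrt_continuous (fun u => u 0 i) X mX) => u.
exact: (@coord_continuous R 1 p 0 i u).
Qed.

(** The rays []a, +oo]] generate, and lower semicontinuity makes their preimages open. *)
Lemma measurable_wrt_lsc (h : 'rV[R]_p -> \bar R) (X : T -> 'rV[R]_p) :
  measurable_wrt G X -> lower_semicontinuous h ->
  measurable_fun (setT : set (g_sigma_algebraType G)) (fun w => h (X w)).
Proof.
move=> mX /lower_semicontinuousP lh; apply: (measurability _ (ErealGenOInfty.measurableE R)).
move=> _ [_ [a ->] <-]; rewrite setTI preimage_itvoy.
have sB : <<s @open 'rV[R]_p >> [set x | (a%:E < h x)%E] by exact: sub_sigma_algebra.
by apply: sub_sigma_algebra; exact: (mX _ sB).
Qed.

End Measurability.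

(** * The Lyapunov recursion in expectation *)

Section RandomVectors.
Context {d : measure_display} {T : measurableType d} {R : realType}
  {P : probability T R} {p : nat}.
Implicit Types X Y : T -> 'rV[R]_p.

Definition coord_measurable X := forall i, measurable_fun setT (fun w => X w 0 i).

Lemma measurable_dot X Y : coord_measurable X -> coord_measurable Y ->
  measurable_fun setT (fun w => dot (X w) (Y w)).
Proof.
by move=> mX mY; apply: measurable_sum => i; exact: measurable_funM.
Qed.

Lemma coord_measurableD X Y : coord_measurable X -> coord_measurable Y ->
  coord_measurable (fun w => X w + Y w).
Proof.
move=> mX mY i; under eq_fun do rewrite mxE; exact: measurable_funD.
Qed.

Lemma coord_measurableZ c X : coord_measurable X -> coord_measurable (fun w => c *: X w).
Proof.
move=> mX i; under eq_fun do rewrite mxE; apply: measurable_funM => //.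
Qed.

Lemma coord_measurable_cst u : coord_measurable (fun=> u).
Proof. by move=> i; exact: measurable_cst. Qed.

Lemma coord_measurableB X Y : coord_measurable X -> coord_measurable Y ->
  coord_measurable (fun w => X w - Y w).
Proof.
move=> mX mY i; under eq_fun do rewrite !mxE; exact: measurable_funB.
Qed.

Lemma integrable_le (u b : T -> R) : measurable_fun setT u ->
  (forall w, `|u w| <= b w) -> P.-integrable setT (EFin \o b) ->
  P.-integrable setT (EFin \o u).
Proof.
move=> mu ub; apply: le_integrable => //; first exact/measurable_EFinP.
by move=> w _ /=; rewrite lee_fin (le_trans (ub w)) // ler_norm.
Qed.

Lemma integrable_lin (a b : R) (u v : T -> R) :
  P.-integrable setT (EFin \o u) -> P.-integrable setT (EFin \o v) ->
  P.-integrable setT (fun w => (a * u w + b * v w)%:E).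
Proof.
move=> iu iv.
have := integrableD measurableT (integrableZl measurableT a iu) (integrableZl measurableT b iv).
by apply: eq_integrable => // w _; rewrite /= EFinD !EFinM.
Qed.

Definition square_integrable X :=
  coord_measurable X /\ P.-integrable setT (fun w => (dot (X w) (X w))%:E).

Lemma square_integrable_le X Y Z (a b : R) : coord_measurable X ->
  square_integrable Y -> square_integrable Z ->
  (forall w, dot (X w) (X w) <= a * dot (Y w) (Y w) + b * dot (Z w) (Z w)) ->
  square_integrable X.
Proof.
move=> mX [mY iY] [mZ iZ] H; split => //.
apply: (integrable_le _ _ (integrable_lin a b iY iZ)); first exact: measurable_dot.
by move=> w; rewrite ger0_norm // dot_ge0.
Qed.

End RandomVectors.

(** * Random iterates of the algorithm with [gamma 0 = mu] *)

Section Process.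
Context {d : measure_display} {T : measurableType d} {R : realType}
  {P : probability T R} {p : nat} {L mu : R} {f : 'rV[R]_p -> R}
  {psi : 'rV[R]_p -> \bar R} {xs : 'rV[R]_p}.
Hypotheses (cp : composite_problem L mu f psi) (mu0 : 0 < mu)
  (xsmin : minimizer (objective f psi) xs) (p0 : (0 < p)%N).
Context {eta gamma delta : nat -> R} {Fl : nat -> set (set T)}
  {x y g : nat -> T -> 'rV[R]_p}.
Hypotheses (HA : algorithmC P L mu f psi eta gamma delta Fl x y g)
  (gamma0 : gamma 0%N = mu).
Context {s2 : R}.
Hypotheses (noise_bound : forall k, (0 < k)%N -> (omega2 P f y g k <= s2%:E)%E)
  (x0_sqint : square_integrable (P := P) (fun w => x 0%N w - xs)).

Let L0 : 0 < L := cp_L_gt0 cp.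
Let sp := ac_parameters HA.
Let etaP k : 0 < eta k <= 1 / L := sp_eta sp k.
Let eta_gt0 k : 0 < eta k. Proof. by case/andP: (etaP k). Qed.

Lemma gamma_eq_mu k : gamma k = mu.
Proof. by elim: k => // k IH; rewrite (sp_gamma sp) IH; ring. Qed.

Lemma delta_sqr k : mu * eta k = delta k ^+ 2.
Proof.
by rewrite (sp_delta sp) gamma_eq_mu sqr_sqrtr ?mulr_ge0 ?ltW // mulrC.
Qed.

Lemma delta_gt0 k : 0 < delta k.
Proof. by rewrite (sp_delta sp) gamma_eq_mu sqrtr_gt0 mulr_gt0. Qed.

Lemma delta_le1 k : delta k <= 1.
Proof.
have d0 := ltW (delta_gt0 k); rewrite -(@expr_le1 _ 2) // -delta_sqr.
have /andP[_ h] := etaP k.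
rewrite [mu * _]mulrC; apply: (@le_trans _ _ (1 / L * mu)); first by rewrite ler_pM2r.
by rewrite mul1r mulrC ler_pdivrMr // mul1r; exact: mu_le_L cp p0.
Qed.

Let deltaP k : 0 < delta k <= 1. Proof. by rewrite delta_gt0 delta_le1. Qed.

(* Chosen so that [x_{k+1} = (1 - delta_{k+1}) x_k + delta_{k+1} v_{k+1}] *)
Definition v_seq k w : 'rV[R]_p :=
  if k is j.+1 then x j w + (delta j.+1)^-1 *: (x j.+1 w - x j w) else x 0%N w.

Lemma x_v_seq k w : x k.+1 w = (1 - delta k.+1) *: x k w + delta k.+1 *: v_seq k.+1 w.
Proof.
rewrite /v_seq; have /lt0r_neq0 h := delta_gt0 k.+1.
by apply/rowP => i; rewrite !mxE; field.
Qed.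

Lemma y_v_seq k w : (1 + delta k.+1) *: y k w = x k w + delta k.+1 *: v_seq k w.
Proof.
have d1 := delta_gt0 k.+1; have h1 := lt0r_neq0 d1.
case: k d1 h1 => [|k] d1 h1 /=.
  by rewrite (ac_y0 HA) scalerDl scale1r.
have d0 := delta_gt0 k.+1; have h0 := lt0r_neq0 d0.
have e j : eta j = mu^-1 * delta j ^+ 2 by rewrite -delta_sqr mulKf // gt_eqF.
rewrite (ac_y HA).
(* Substituting [eta j = delta j ^+ 2 / mu] cancels [mu] and one factor of each of the two
   deltas. *)
have -> : beta eta delta k.+1 =
    (1 - delta k.+1) * delta k.+2 / (delta k.+1 * (1 + delta k.+2)).
  rewrite /beta !e; field.
  by rewrite !gt_eqF ?addr_gt0 ?mulr_gt0 ?exprn_gt0.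
apply/rowP => i; rewrite !mxE; field.
by rewrite !gt_eqF ?addr_gt0.
Qed.

Let zeta k w := g k.+1 w - grad f (y k w).

Let filtr := ac_filtration HA.
Let sFl k : sigma_algebra setT (Fl k). Proof. by case: filtr. Qed.
Let mFl k : Fl k `<=` measurable. Proof. by case: filtr. Qed.

Lemma measurable_wrt_coord_measurable k (X : T -> 'rV[R]_p) :
  measurable_wrt (Fl k) X -> coord_measurable X.
Proof.
move=> mX i; apply: (sub_sigma_measurable_fun (sFl k) (@mFl k)).
exact: measurable_wrt_coord.
Qed.

Let mx k : coord_measurable (x k).
Proof. exact: measurable_wrt_coord_measurable (ac_x_adapted HA k). Qed.
Let my k : coord_measurable (y k).
Proof. exact: measurable_wrt_coord_measurable (ac_y_adapted HA k). Qed.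

Lemma zeta_integrable k i : P.-integrable setT (fun w => (zeta k w 0 i)%:E).
Proof.
have [_ /(_ i)[iX iZ _]] := ac_unbiased HA k.
have := integrableB measurableT iX iZ.
by apply: eq_integrable => // w _; rewrite /zeta !mxE -EFinB.
Qed.

Lemma zeta_integral0 k i A : Fl k A -> (\int[P]_(w in A) (zeta k w 0 i)%:E = 0)%E.
Proof.
move=> FA; have mA : measurable A by exact: mFl FA.
have [_ /(_ i)[iX iZ e]] := ac_unbiased HA k.
have sub := subsetT A.
have iXA := integrableS measurableT mA sub iX.
have iZA := integrableS measurableT mA sub iZ.
have E w : zeta k w 0 i = g k.+1 w 0 i - grad f (y k w) 0 i by rewrite /zeta !mxE.
under eq_integral do rewrite E EFinB.
rewrite integralB // e // subee //.
exact: integrable_fin_num.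
Qed.

Lemma zeta_coord_measurable k : coord_measurable (zeta k).
Proof. by move=> i; apply/measurable_EFinP; exact: measurable_int (zeta_integrable k i). Qed.

Lemma zeta_sqr_integral k : (\int[P]_w (dot (zeta k w) (zeta k w))%:E <= s2%:E)%E.
Proof.
have := noise_bound (ltn0Sn k); rewrite /omega2 /= unlock.
apply: le_trans; rewrite le_eqVlt; apply/orP; left; apply/eqP.
apply: eq_integral => w _; rewrite enorm_sqr /zeta.
by rewrite -opprB dotNl dotNr opprK.
Qed.

Lemma zeta_sqint k : square_integrable (P := P) (zeta k).
Proof.
split; first exact: zeta_coord_measurable.
apply/integrableP; split.
  by apply/measurable_EFinP/measurable_dot; exact: zeta_coord_measurable.
apply: (@le_lt_trans _ _ s2%:E); last exact: ltry.
apply: le_trans (zeta_sqr_integral k); rewrite le_eqVlt; apply/orP; left; apply/eqP.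
by apply: eq_integral => w _; rewrite /= ger0_norm // dot_ge0.
Qed.

Let mB k : coord_measurable (fun w => x k w - xs).
Proof. by apply: coord_measurableB => //; exact: coord_measurable_cst. Qed.

(** Joint induction: [prox_grad_dist] controls the next [x] by the noise and [y], and the next [y]
    is an affine combination of two successive [x]. *)
Lemma xy_sqint k : square_integrable (P := P) (fun w => x k w - xs) /\
  square_integrable (P := P) (fun w => y k w - xs).
Proof.
elim: k => [|k [IHx IHy]].
  split => //; rewrite (_ : (fun w => _) = (fun w => x 0%N w - xs)) //.
  by apply/funext => w; rewrite (ac_y0 HA).
have sx : square_integrable (P := P) (fun w => x k.+1 w - xs).
  apply: (square_integrable_le (mB k.+1) (zeta_sqint k) IHy (a := 4 * eta k.+1 ^+ 2) (b := 2)) => w.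
  have := prox_grad_dist cp mu0 xsmin (etaP _) (ac_x HA k w). exact.
split => //; set b := beta eta delta k.+1.
apply: (square_integrable_le _ sx IHx (a := 2 * (1 + b) ^+ 2) (b := 2 * b ^+ 2)).
  by apply: coord_measurableB => //; exact: coord_measurable_cst.
move=> w; rewrite (ac_y HA) -/b.
have -> : x k.+1 w + b *: (x k.+1 w - x k w) - xs =
    (1 + b) *: (x k.+1 w - xs) - b *: (x k w - xs).
  by apply/rowP => i; rewrite !mxE; ring.
by apply: le_trans (dot_subsqr _ _) _; rewrite !dotZl !dotZr le_eqVlt; apply/orP; left; apply/eqP; ring.
Qed.

Lemma v_sqint k : square_integrable (P := P) (fun w => v_seq k w - xs).
Proof.
case: k => [|k]; first by case: (xy_sqint 0).
set c := (delta k.+1)^-1.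
apply: (square_integrable_le _ (xy_sqint k.+1).1 (xy_sqint k).1
   (a := 2 * c ^+ 2) (b := 2 * (1 - c) ^+ 2)) => [|w].
  apply: coord_measurableB; last exact: coord_measurable_cst.
  apply: coord_measurableD => //; apply: coord_measurableZ.
  exact: coord_measurableB.
rewrite /= -/c.
have -> : x k w + c *: (x k.+1 w - x k w) - xs =
    c *: (x k.+1 w - xs) + (1 - c) *: (x k w - xs).
  by apply/rowP => i; rewrite !mxE; ring.
by apply: le_trans (dot_addsqr _ _) _; rewrite !dotZl !dotZr le_eqVlt; apply/orP; left; apply/eqP; ring.
Qed.

Lemma gap_measurable k : measurable_fun setT (fun w => gap f psi xs (x k w)).
Proof.
have ax := ac_x_adapted HA k.
apply: emeasurable_funB; last exact: measurable_cst.
apply: emeasurable_funD.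
  apply/measurable_EFinP; apply: (sub_sigma_measurable_fun (sFl k) (@mFl k)).
  apply: (@measurable_wrt_continuous _ _ _ _ _ f _ ax) => u.
  exact: differentiable_continuous ((cp_smooth cp).1 u).
apply: (sub_sigma_measurable_fun (sFl k) (@mFl k)).
exact: measurable_wrt_lsc ax (cp_lsc cp).
Qed.

(** One proximal step suffices: from index [1] on the gap is integrable, even when the initial point
    lies outside the domain of [psi]. *)
Lemma gap_integrable k : P.-integrable setT (fun w => gap f psi xs (x k.+1 w)).
Proof.
have iz := (zeta_sqint k).2; have iy := (xy_sqint k).2.2.
have [s hs] := minimizer_EFin cp xsmin.
apply: le_integrable (integrable_lin (eta k.+1 / 2) (2 * eta k.+1)^-1 iz iy) => //.
  exact: gap_measurable.
move=> w _; have px := ac_x HA k w.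
have [r hr] := prox_EFin (cp_proper cp) (eta_gt0 _) px.
have := prox_grad_gap cp mu0 (etaP _) px hr hs.
rewrite (gee0_abs (gap_ge0 cp xsmin _)) (gapE hr hs) /= lee_fin => H.
by apply: le_trans H _; rewrite ler_norm.
Qed.

Definition lyap_proc k w := lyap mu f psi xs (x k w) (v_seq k w).

Lemma lyap_ge0 k w : (0 <= lyap_proc k w)%E.
Proof.
rewrite adde_ge0 ?(gap_ge0 cp xsmin) // lee_fin.
by rewrite mulr_ge0 ?dot_ge0 // divr_ge0 // ltW.
Qed.

Lemma lyap_integrable_of k : P.-integrable setT (fun w => gap f psi xs (x k w)) ->
  P.-integrable setT (lyap_proc k).
Proof.
move=> ig; apply: (integrableD measurableT ig).
have := integrableZl measurableT (mu / 2) (v_sqint k).2.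
by apply: eq_integrable => // w _; rewrite EFinM.
Qed.

Lemma gap_le_lyap k :
  (\int[P]_w gap f psi xs (x k w) <= \int[P]_w lyap_proc k w)%E.
Proof.
apply: ge0_le_integral => //.
- by move=> w _; exact: gap_ge0 cp xsmin _.
- exact: gap_measurable.
- apply: emeasurable_funD; first exact: gap_measurable.
  apply/measurable_EFinP; apply: measurable_funM => //.
  by have [m _] := v_sqint k; exact: measurable_dot.
- by move=> w _; rewrite leeDl // lee_fin mulr_ge0 ?dot_ge0 // divr_ge0 // ltW.
Qed.

Lemma lyap_step_expect k : P.-integrable setT (lyap_proc k) ->
  (\int[P]_w lyap_proc k.+1 w <=
   (1 - delta k.+1)%:E * \int[P]_w lyap_proc k w + (eta k.+1 * s2)%:E)%E.
Proof.
move=> iV.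
have ex u := prox_exists cp xsmin u (etaP k.+1).
(* The choice is made on vectors, not on sample points, so that continuity of [q] makes [q (y k w)]
   measurable with respect to [Fl k]. *)
pose q u := xget 0 [set v | is_prox (eta k.+1) psi (u - eta k.+1 *: grad f u) v].
have hq u : is_prox (eta k.+1) psi (u - eta k.+1 *: grad f u) (q u).
  by have [v hv] := ex u; exact: (xgetPex 0 (ex u)).
have cq : continuous q by move=> u; exact: (prox_map_continuous cp (etaP k.+1) hq).
(* [W] is [F_k]-measurable, so it is orthogonal to the noise [zeta k] *)
pose W w := (1 - delta k.+1) *: x k w + delta k.+1 *: xs - q (y k w).
have mW i : measurable_fun (setT : set (g_sigma_algebraType (Fl k))) (fun w => W w 0 i).
  have m1 : measurable_fun (setT : set (g_sigma_algebraType (Fl k))) (fun w => x k w 0 i).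
    exact: measurable_wrt_coord (ac_x_adapted HA k).
  have m2 : measurable_fun (setT : set (g_sigma_algebraType (Fl k))) (fun w => q (y k w) 0 i).
    apply: (@measurable_wrt_continuous _ _ _ _ _ (fun u => q u 0 i) _ (ac_y_adapted HA k)) => u.
    exact: (continuous_comp (cq u) (@coord_continuous R 1 p 0 i (q u))).
  under eq_fun do rewrite !mxE.
  apply: measurable_funB => //; apply: measurable_funD; last exact: measurable_cst.
  by apply: measurable_funM => //; exact: measurable_cst.
have sW : square_integrable (P := P) W.
  apply: (square_integrable_le _ (xy_sqint k).1 (xy_sqint k).2 (a := 2) (b := 4)).
    by move=> i; exact: (sub_sigma_measurable_fun (sFl k) (@mFl k) (mW i)).
  move=> w; apply: (prox_grad_test_dist cp mu0 xsmin _ (etaP k.+1)) (hq _).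
  by have /andP[d0 d1] := deltaP k.+1; rewrite ltW.
have iZW i : P.-integrable setT (fun w => (zeta k w 0 i * W w 0 i)%:E).
  apply: (integrable_le _ _ (integrable_lin 1 1 (zeta_sqint k).2 sW.2)).
    by apply: measurable_funM; [exact: zeta_coord_measurable|exact: sW.1].
  move=> w; rewrite !mul1r normrM.
  have := dot_sqr_coord (zeta k w) i; have := dot_sqr_coord (W w) i.
  rewrite -(real_normK (num_real (W w 0 i))) -(real_normK (num_real (zeta k w 0 i))).
  by have := sqr_ge0 (`|zeta k w 0 i| - `|W w 0 i|); have := sqr_ge0 (`|zeta k w 0 i| + `|W w 0 i|); lra.
have iN : P.-integrable setT (fun w => (dot (zeta k w) (W w))%:E).
  under eq_fun do rewrite /dot -sumEFin.
  by apply: integrable_sum => // i _; exact: iZW.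
have N0 : (\int[P]_w (dot (zeta k w) (W w))%:E = 0)%E.
  under eq_integral do rewrite /dot -sumEFin.
  rewrite integral_sum // big1 // => i _.
  apply: (integral_mul_eq0 (sFl k) (@mFl k) (zeta_integrable k i) _ (mW i) (iZW i)).
  by move=> A; exact: zeta_integral0.
have iz2 := (zeta_sqint k).2.
have iE : P.-integrable setT (fun w => (dot (zeta k w) (W w))%:E + (eta k.+1)%:E * (dot (zeta k w) (zeta k w))%:E)%E.
  by apply: integrableD => //; exact: integrableZl.
have iR : P.-integrable setT (fun w => (1 - delta k.+1)%:E * lyap_proc k w)%E.
  exact: integrableZl.
apply: (@le_trans _ _ (\int[P]_w ((1 - delta k.+1)%:E * lyap_proc k w +
   ((dot (zeta k w) (W w))%:E + (eta k.+1)%:E * (dot (zeta k w) (zeta k w))%:E)))%E).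
  apply: le_integral => //.
  - exact: lyap_integrable_of (gap_integrable k).
  - exact: integrableD.
  - move=> w _; rewrite -EFinM -EFinD.
    have := lyapunov_step cp mu0 xsmin (etaP _) (deltaP _) (delta_sqr _)
      (y_v_seq k w) (ac_x HA k w) (hq _) (x_v_seq k w).
    exact.
rewrite integralD // integralZl // integralD //; last exact: integrableZl.
rewrite N0 add0e integralZl // leeD2l // EFinM.
by apply: lee_wpmul2l; [rewrite lee_fin ltW | exact: zeta_sqr_integral].
Qed.

Lemma lyap_integral_EFin k : P.-integrable setT (lyap_proc k) ->
  exists a : R, (\int[P]_w lyap_proc k w = a%:E)%E.
Proof.
move=> iV; exists (fine (\int[P]_w lyap_proc k w)); rewrite fineK //.
exact: integrable_fin_num.
Qed.

Lemma lyap_integrableS k : P.-integrable setT (lyap_proc k.+1).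
Proof. exact: lyap_integrable_of (gap_integrable k). Qed.

Lemma lyap0_integrable (a : R) :
  (\int[P]_w gap f psi xs (x 0%N w) <= a%:E)%E -> P.-integrable setT (lyap_proc 0).
Proof.
move=> ga; apply: lyap_integrable_of; apply/integrableP; split; first exact: gap_measurable.
under eq_integral do rewrite (gee0_abs (gap_ge0 cp xsmin _)).
by apply: le_lt_trans ga _; exact: ltry.
Qed.

(** Since [v_0 = x_0], quadratic growth bounds the distance term by the gap itself. *)
Lemma lyap0_le (a : R) : (\int[P]_w gap f psi xs (x 0%N w) <= a%:E)%E ->
  (\int[P]_w lyap_proc 0 w <= (2 * a)%:E)%E.
Proof.
move=> ga; apply: (@le_trans _ _ (\int[P]_w (2%:E * gap f psi xs (x 0%N w)))%E).
  apply: ge0_le_integral => //.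
  - by move=> w _; exact: lyap_ge0.
  - exact: measurable_int (lyap0_integrable ga).
  - by apply: measurable_funeM; exact: gap_measurable.
  - move=> w _; rewrite /lyap_proc /lyap /= (_ : 2%:E = 1%:E + 1%:E)%E //.
    rewrite ge0_muleDl // mul1e leeD2l //; exact: quadratic_growth cp xsmin _.
rewrite ge0_integralZl //; last 2 first.
- exact: gap_measurable.
- by move=> w _; exact: gap_ge0 cp xsmin _.
by rewrite EFinM; apply: lee_wpmul2l => //; rewrite lee_fin.
Qed.

(** As [eta * s2 = s2 / mu * de^2], the noise floor [s2 / mu * de] is the fixed point of the
    recursion. The starting index [m] is free because the value at index [0] may be infinite. *)
Lemma lyap_expect_geometric (de a : R) m n : (forall k, delta k = de) ->
  P.-integrable setT (lyap_proc m) -> (\int[P]_w lyap_proc m w <= a%:E)%E ->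
  (\int[P]_w lyap_proc (n + m) w <= ((1 - de) ^+ n * a + s2 / mu * de)%:E)%E.
Proof.
move=> hd im ha.
have de0 : 0 < de by rewrite -(hd 0%N) delta_gt0.
have de1 : de <= 1 by rewrite -(hd 0%N) delta_le1.
have s20 : 0 <= s2.
  rewrite -lee_fin; apply: le_trans (zeta_sqr_integral 0).
  by apply: integral_ge0 => w _; rewrite lee_fin dot_ge0.
elim: n => [|n IH].
  rewrite add0n expr0 mul1r; apply: le_trans ha _.
  by rewrite lee_fin lerDl !mulr_ge0 // ?invr_ge0 ltW.
have inm : P.-integrable setT (lyap_proc (n + m)).
  by case: n {IH} => [//|n]; exact: lyap_integrableS.
rewrite addSn; apply: le_trans (lyap_step_expect inm) _.
rewrite hd; have e : eta (n + m).+1 = de ^+ 2 / mu.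
  by rewrite -(hd (n + m).+1) -delta_sqr mulrC mulKf // gt_eqF.
apply: (@le_trans _ _ ((1 - de)%:E * ((1 - de) ^+ n * a + s2 / mu * de)%:E
    + (eta (n + m).+1 * s2)%:E)%E).
  by rewrite leeD2r //; apply: lee_wpmul2l => //; rewrite lee_fin subr_ge0.
rewrite -EFinM -EFinD lee_fin e le_eqVlt; apply/orP; left; apply/eqP.
rewrite (exprS _ n); move: ((1 - de) ^+ n) => q; ring.
Qed.

Lemma lyap_expect_decreasing (de : R) :
  (forall k, delta k = Num.min de (2 / (k%:R + 2))) ->
  P.-integrable setT (lyap_proc 0) ->
  (\int[P]_w lyap_proc 0 w <= (4 * (s2 / mu) * delta 0%N)%:E)%E ->
  forall k, (\int[P]_w lyap_proc k w <= (4 * (s2 / mu) * delta k)%:E)%E.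
Proof.
move=> hd i0 h0.
have s20 : 0 <= s2 / mu.
  rewrite divr_ge0 //; last exact: ltW.
  rewrite -lee_fin; apply: le_trans (zeta_sqr_integral 0).
  by apply: integral_ge0 => w _; rewrite lee_fin dot_ge0.
elim=> [//|k IH].
have ik : P.-integrable setT (lyap_proc k).
  by case: k {IH} => [//|k]; exact: lyap_integrableS.
apply: le_trans (lyap_step_expect ik) _.
have e : eta k.+1 = delta k.+1 ^+ 2 / mu by rewrite -delta_sqr mulrC mulKf // gt_eqF.
apply: (@le_trans _ _ ((1 - delta k.+1)%:E * (4 * (s2 / mu) * delta k)%:E
    + (eta k.+1 * s2)%:E)%E).
  by rewrite leeD2r //; apply: lee_wpmul2l => //; rewrite lee_fin subr_ge0 delta_le1.
rewrite -EFinM -EFinD lee_fin e.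
(* The induction step divided by the common factor [s2 / mu]. *)
suff : (1 - delta k.+1) * (4 * delta k) + delta k.+1 ^+ 2 <= 4 * delta k.+1.
  move=> /(ler_wpM2l s20); set D := delta k; set D' := delta k.+1; lra.
have d1 := delta_le1 k.+1.
have dk : delta k <= de by rewrite hd ge_min lexx.
have dk2 : delta k <= 2 / (k%:R + 2) by rewrite hd ge_min lexx orbT.
have : delta k.+1 = de \/ delta k.+1 = 2 / (k.+1%:R + 2).
  by rewrite hd; case: leP => _; [left|right].
have := delta_gt0 k; have := delta_gt0 k.+1.
move: dk dk2 d1; set D := delta k; set D' := delta k.+1 => dk dk2 d1 D'0 D0.
(* While the constant step is active, [D <= D'] and the claim is immediate; afterwards [D] is
   replaced by its bound [2 / (k + 2)] and the difference is an explicit positive fraction. *)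
case=> [e'|e']; first by rewrite -e' in dk; nra.
have k2 : 0 < k%:R + 2 :> R by rewrite ltr_wpDl.
have k3 : 0 < k.+1%:R + 2 :> R by rewrite ltr_wpDl.
have H : (1 - D') * (4 * D) <= (1 - D') * (4 * (2 / (k%:R + 2))).
  by rewrite ler_wpM2l ?subr_ge0 // ler_pM2l.
apply: le_trans (lerD H (lexx _)) _; rewrite -subr_ge0.
have -> : 4 * D' - ((1 - D') * (4 * (2 / (k%:R + 2))) + D' ^+ 2) =
    4 * (k%:R + 4) / ((k%:R + 2) * (k.+1%:R + 2) ^+ 2).
  by rewrite e' -(natr1 k); field; rewrite natr1 !gt_eqF.
apply: divr_ge0; first by rewrite mulr_ge0 // addr_ge0.
by rewrite mulr_ge0 ?sqr_ge0 // addr_ge0.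
Qed.

End Process.

(** From [1 - de <= exp (- de)], the exponent [n] just above [ln (A / e) / de] works. When [A < e],
    [n = 0] does, and the logarithm may be negative or meaningless, hence the guarded bound. *)
Lemma geometric_small {R : realType} (de A e : R) : 0 < de <= 1 -> 0 < e ->
  exists n : nat, (1 - de) ^+ n * A <= e /\
    (e <= A -> n%:R <= de^-1 * ln (A / e) + 1).
Proof.
move=> /andP[d0 d1] e0.
have [Ae|eA] := ltP A e.
  by exists 0%N; rewrite expr0 mul1r ltW //; split => // /(lt_le_trans Ae); rewrite ltxx.
have A0 : 0 < A by exact: lt_le_trans eA.
pose t := de^-1 * ln (A / e).
have t0 : 0 <= t.
  by rewrite mulr_ge0 ?invr_ge0 ?(ltW d0) // ln_ge0 // ler_pdivlMr // mul1r.
exists (Num.truncn t).+1; have /andP[lo hi] := truncn_itv t0; split; last first.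
  by move=> _; rewrite -natr1 lerD2r.
set n := (Num.truncn t).+1 in hi *.
have h1 : (1 - de) ^+ n <= expR (- de) ^+ n.
  by rewrite lerXn2r ?nnegrE ?subr_ge0 ?expR_ge0 // expR_ge1Dx.
have h2 : expR (- de) ^+ n <= e / A.
  rewrite -expRM_natl; apply: (@le_trans _ _ (expR (- ln (A / e)))).
    rewrite ler_expR mulrN lerN2.
    move: (ltW hi); rewrite /t -[leRHS]mulr1 => hi'.
    by rewrite -(ler_pM2l (_ : 0 < de^-1)) ?invr_gt0 // mulrCA mulVf ?gt_eqF.
  by rewrite expRN lnK ?posrE ?divr_gt0 // invf_div.
apply: (@le_trans _ _ (e / A * A)); last by rewrite divfK // gt_eqF.
by rewrite ler_pM2r // (le_trans h1).
Qed.

(** * Complexity of the restarted scheme *)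

Section StepSizes.
Context {R : realType} {L mu : R} {eta gamma delta : nat -> R}.
Hypotheses (mu0 : 0 < mu) (L0 : 0 < L) (sp : step_parameters L mu eta gamma delta)
  (gamma0 : gamma 0%N = mu).

Let step_sqr k : 0 <= delta k /\ delta k ^+ 2 = mu * eta k.
Proof.
have g k' : gamma k' = mu by elim: k' => // j IH; rewrite (sp_gamma sp) IH; ring.
have /andP[e0 _] := sp_eta sp k.
by rewrite (sp_delta sp) sqrtr_ge0 sqr_sqrtr g ?mulr_ge0 ?ltW // mulrC.
Qed.

Lemma delta_const : (forall k, eta k = 1 / L) -> forall k, delta k = Num.sqrt (mu / L).
Proof.
move=> he k; have [d0 d2] := step_sqr k; apply/eqP.
rewrite -(eqrXn2 (_ : (0 < 2)%N)) ?sqrtr_ge0 // d2 he sqr_sqrtr ?divr_ge0 ?ltW //.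
by rewrite mulrA mulr1.
Qed.

Lemma delta_decreasing : (forall k, eta k = eta_decreasing L mu k) ->
  forall k, delta k = Num.min (Num.sqrt (mu / L)) (2 / (k%:R + 2)).
Proof.
move=> he k; have [d0 d2] := step_sqr k; apply/eqP.
set de := Num.sqrt (mu / L).
have k2 : 0 < k%:R + 2 :> R by rewrite ltr_wpDl.
have de2 : de ^+ 2 = mu / L by rewrite sqr_sqrtr // divr_ge0 // ltW.
have b0 : 0 <= 2 / (k%:R + 2) :> R by rewrite divr_ge0 // ltW.
rewrite -(eqrXn2 (_ : (0 < 2)%N)) // ?le_min ?sqrtr_ge0 // d2 he /eta_decreasing.
have E1 : mu * (1 / L) = de ^+ 2 by rewrite de2 mulrA mulr1.
have E2 : mu * (4 / (mu * (k%:R + 2) ^+ 2)) = (2 / (k%:R + 2)) ^+ 2.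
  by field; rewrite !gt_eqF.
rewrite minr_pMr ?ltW // E1 E2.
case: (leP de) => h.
  by rewrite min_l // lerXn2r ?nnegrE ?sqrtr_ge0.
by rewrite min_r // lerXn2r ?nnegrE ?sqrtr_ge0 // ltW.
Qed.

End StepSizes.

Lemma log_plus_ge0 {R : realType} (z : \bar R) : (0 <= log_plus z)%E.
Proof. by rewrite /log_plus le_max lexx orbT. Qed.

Lemma log_plus_ge_ln {R : realType} (r : R) : 0 < r -> ((ln r)%:E <= log_plus r%:E)%E.
Proof. by move=> r0; rewrite /log_plus lne_EFin // le_max lexx. Qed.

Section Restart.
Context {d : measure_display} {T : measurableType d} {R : realType}
  {P : probability T R} {p : nat} {L mu : R} {f : 'rV[R]_p -> R}
  {psi : 'rV[R]_p -> \bar R} {xs : 'rV[R]_p}.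
Hypotheses (cp : composite_problem L mu f psi) (mu0 : 0 < mu)
  (xsmin : minimizer (objective f psi) xs) (p0 : (0 < p)%N).
Let F := objective f psi.
Let L0 : 0 < L := cp_L_gt0 cp.
Let de := Num.sqrt (mu / L).

Let de_gt0 : 0 < de. Proof. by rewrite sqrtr_gt0 divr_gt0. Qed.
Let de_le1 : de <= 1.
Proof.
rewrite -(@expr_le1 _ 2) ?(ltW de_gt0) // sqr_sqrtr; last by rewrite divr_ge0 // ltW.
by rewrite ler_pdivrMr // mul1r; exact: mu_le_L cp p0.
Qed.

Lemma expected_gap_cst (X : T -> 'rV[R]_p) (x0 : 'rV[R]_p) (G : R) :
  (forall w, X w = x0) -> gap f psi xs x0 = G%:E ->
  expected_gap P F xs X = G%:E.
Proof.
move=> hX hG; have e w : (F (X w) - F xs = cst G%:E w)%E by rewrite hX; exact: hG.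
rewrite /expected_gap; under eq_integral do rewrite e.
by rewrite integral_cst // [X in (_ * X)%E]probability_setT mule1.
Qed.

(** The second bound counts iterations when the initial gap is finite. The third starts from index
    [1] with an unspecified [a]; it still shows that the first stage ends when the initial gap is
    infinite. Square integrability permits the restart. *)
Lemma constant_step_expected_gap gamma delta Fl x y g (s2 : R) (x0 : 'rV[R]_p) :
  algorithmC P L mu f psi (fun=> 1 / L) gamma delta Fl x y g ->
  gamma 0%N = mu -> (forall w, x 0%N w = x0) ->
  (forall k, (0 < k)%N -> (omega2 P f y g k <= s2%:E)%E) ->
  [/\ forall k, square_integrable (P := P) (fun w => x k w - xs),
      forall (G : R) n, gap f psi xs x0 = G%:E ->
        (expected_gap P F xs (x n) <= ((1 - de) ^+ n * (2 * G) + s2 / mu * de)%:E)%E &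
      exists a : R, forall n,
        (expected_gap P F xs (x n.+1) <= ((1 - de) ^+ n * a + s2 / mu * de)%:E)%E].
Proof.
move=> HA g0 hx0 hn.
have hd : forall k, delta k = de.
  exact: (delta_const mu0 L0 (ac_parameters HA) g0).
have x0i : square_integrable (P := P) (fun w => x 0%N w - xs).
  rewrite (_ : (fun w => _) = (fun=> x0 - xs)); last by apply/funext => w; rewrite hx0.
  split; first exact: coord_measurable_cst.
  exact: finite_measure_integrable_cst.
split.
- by move=> k; exact: (xy_sqint cp mu0 xsmin HA hn x0i k).1.
- move=> G n hG.
  have e0 : (\int[P]_w gap f psi xs (x 0%N w) <= G%:E)%E.
    by have := expected_gap_cst hx0 hG; rewrite /expected_gap /gap => ->.
  apply: (le_trans (gap_le_lyap cp mu0 xsmin HA hn x0i n)).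
  have i0 := lyap0_integrable cp mu0 xsmin HA hn x0i e0.
  have := lyap_expect_geometric cp mu0 xsmin p0 HA g0 hn x0i n hd i0
    (lyap0_le cp mu0 xsmin HA hn x0i e0).
  by rewrite addn0.
- have i1 := lyap_integrableS cp mu0 xsmin HA hn x0i 0.
  have [a ha] := lyap_integral_EFin i1.
  exists a => n.
  apply: (le_trans (gap_le_lyap cp mu0 xsmin HA hn x0i n.+1)).
  have := lyap_expect_geometric cp mu0 xsmin p0 HA g0 hn x0i n hd i1 _.
  by rewrite addn1; apply; rewrite ha.
Qed.

Lemma decreasing_step_expected_gap gamma delta Fl x y g (s2 : R) :
  algorithmC P L mu f psi (eta_decreasing L mu) gamma delta Fl x y g ->
  gamma 0%N = mu -> square_integrable (P := P) (fun w => x 0%N w - xs) ->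
  (forall k, (0 < k)%N -> (omega2 P f y g k <= s2%:E)%E) ->
  (expected_gap P F xs (x 0%N) <= (2 * (s2 / mu) * de)%:E)%E ->
  forall k, (expected_gap P F xs (x k) <= (8 * (s2 / mu) / (k%:R + 2))%:E)%E.
Proof.
move=> HA g0 x0i hn h0 k.
have hd : forall k, delta k = Num.min de (2 / (k%:R + 2)).
  exact: (delta_decreasing mu0 L0 (ac_parameters HA) g0).
have i0 := lyap0_integrable cp mu0 xsmin HA hn x0i h0.
apply: (le_trans (gap_le_lyap cp mu0 xsmin HA hn x0i k)).
have s20 : 0 <= s2 / mu.
  rewrite divr_ge0 //; last exact: ltW.
  rewrite -lee_fin; apply: le_trans (hn 1%N isT).
  by rewrite /omega2 unlock; apply: integral_ge0 => w _; rewrite lee_fin sqr_ge0.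
have := lyap_expect_decreasing cp mu0 xsmin p0 HA g0 hn x0i hd i0 _ k.
move=> /(_ _)/le_trans; apply.
  (* [delta 0 = min (de, 2 / 2) = de], so twice the initial gap bound is exactly the invariant at
     [0]. *)
  apply: le_trans (lyap0_le cp mu0 xsmin HA hn x0i h0) _.
  by have := de_le1; rewrite lee_fin hd add0r divff // => /min_idPl ->; lra.
rewrite lee_fin; have : delta k <= 2 / (k%:R + 2) by rewrite hd ge_min lexx orbT.
move=> /(ler_wpM2l s20); lra.
Qed.

End Restart.

Unset Implicit Arguments.

Theorem corollary14 :
  exists C1 C2 : nat,
  forall (R : realType) (p : nat) (L mu sigma eps : R)
    (f : 'rV[R]_p -> R) (psi : 'rV[R]_p -> \bar R) (x0 xs : 'rV[R]_p)
    (d : measure_display) (T : measurableType d) (P : probability T R),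
  let F := objective f psi in
  let threshold := 2 * sigma ^+ 2 / Num.sqrt (mu * L) in
  composite_problem L mu f psi ->
  0 < mu ->
  minimizer F xs ->
  0 < eps -> eps < threshold ->
  forall (gamma delta : nat -> R) (Fl : nat -> set (set T))
    (x y g : nat -> T -> 'rV[R]_p),
  algorithmC P L mu f psi (fun=> 1 / L) gamma delta Fl x y g ->
  gamma 0%N = mu ->
  (forall w, x 0%N w = x0) ->
  (forall k, (0 < k)%N -> (omega2 P f y g k <= (sigma ^+ 2)%:E)%E) ->
  exists K1 : nat,
  [/\ (expected_gap P F xs (x K1) <= threshold%:E)%E,
      (forall j, (j < K1)%N ->
         ~ (expected_gap P F xs (x j) <= threshold%:E)%E) &
  forall (gamma' delta' : nat -> R) (Fl' : nat -> set (set T))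
    (x' y' g' : nat -> T -> 'rV[R]_p),
  algorithmC P L mu f psi (eta_decreasing L mu) gamma' delta' Fl' x' y' g' ->
  gamma' 0%N = mu ->
  (forall w, x' 0%N w = x K1 w) ->
  (forall k, (0 < k)%N -> (omega2 P f y' g' k <= (sigma ^+ 2)%:E)%E) ->
  exists K2 : nat,
    (expected_gap P F xs (x' K2) <= eps%:E)%E /\
    ((K1 + K2)%:R%:E <=
       C1%:R%:E * (Num.sqrt (L / mu))%:E
         * log_plus ((F x0 - F xs) * (eps^-1)%:E)
       + C2%:R%:E * (sigma ^+ 2 / (mu * eps))%:E)%E].
Proof.
(* [18 = 8 + 10]: the additive constants of the two stages are at most
   [8 sigma^2 / (mu eps)] and [10 sigma^2 / (mu eps)]. *)
exists 1%N, 18%N => R p L mu sigma eps f psi x0 xs d T P F threshold cp mu0 xsmin.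
move=> eps0 epst gamma delta Fl x y g HA g0 hx0 hn.
have L0 := cp_L_gt0 cp.
have rhs_ge0 : (0 <= 1%:R%:E * (Num.sqrt (L / mu))%:E
         * log_plus ((F x0 - F xs) * (eps^-1)%:E)
       + 18%:R%:E * (sigma ^+ 2 / (mu * eps))%:E)%E.
  apply: adde_ge0.
    by rewrite mule_ge0 ?log_plus_ge0 // -EFinM lee_fin mul1r sqrtr_ge0.
  by rewrite -EFinM lee_fin mulr_ge0 // divr_ge0 ?sqr_ge0 // mulr_ge0 // ltW.
(* In dimension zero [mu <= L] may fail, but every vector equals [xs] and both counts are zero. *)
have [p0|p0] := posnP p.
  have [s hs] := minimizer_EFin cp xsmin.
  have gap0 (X : T -> 'rV[R]_p) e : 0 <= e -> (expected_gap P F xs X <= e%:E)%E.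
    move=> e0; rewrite /expected_gap integral0_eq ?lee_fin // => w _.
    have -> : X w = xs by apply/rowP => i; have := ltn_ord i; rewrite {2}p0.
    by have := gapE (f := f) hs hs; rewrite subrr.
  exists 0%N; split => //.
    by apply: gap0; rewrite ltW // (lt_trans eps0).
  by move=> *; exists 0%N; split; [apply: gap0; rewrite ltW|rewrite addn0].
set de := Num.sqrt (mu / L).
have de0 : 0 < de by rewrite sqrtr_gt0 divr_gt0.
have de2 : de ^+ 2 = mu / L by rewrite sqr_sqrtr // divr_ge0 // ltW.
have de1 : de <= 1.
  rewrite -(@expr_le1 _ 2) ?(ltW de0) // de2.
  by rewrite ler_pdivrMr // mul1r; exact: mu_le_L cp p0.
have deV : Num.sqrt (L / mu) = de^-1 by rewrite -sqrtrV ?invf_div // divr_ge0 // ltW.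
set S := sigma ^+ 2 / mu.
(* The threshold is twice the noise floor [S * de], because [sqrt (mu * L) = mu / de]. *)
have thE : threshold = 2 * S * de.
  have -> : threshold = 2 * sigma ^+ 2 / (mu / de).
    rewrite /threshold; congr (_ / _); apply/eqP.
    rewrite -(eqrXn2 (_ : (0 < 2)%N)) ?sqrtr_ge0 ?divr_ge0 ?(ltW mu0) ?(ltW de0) //.
    rewrite exprMn exprVn de2 sqr_sqrtr ?mulr_ge0 ?(ltW mu0) ?(ltW L0) //.
    by apply/eqP; field; rewrite !gt_eqF.
  by rewrite /S; field; rewrite !gt_eqF.
have epsS : eps < 2 * S * de by rewrite -thE.
have [sqi fin_bound [a inf_bound]] := constant_step_expected_gap cp mu0 xsmin p0 HA g0 hx0 hn.
have Sde0 : 0 < S * de by lra.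
have dP : 0 < de <= 1 by rewrite de0.
(* Once the geometric term is below [S * de], it fits under the threshold together with the noise
   floor. *)
have reach : exists k, `[< (expected_gap P F xs (x k) <= threshold%:E)%E >].
  have [n [hn' _]] := @geometric_small R de a (S * de) dP Sde0.
  exists n.+1; apply/asboolP; apply: le_trans (inf_bound n) _.
  by rewrite lee_fin thE -/S -/de; lra.
case: (ex_minnP reach) => K1 /asboolP hK1 minK1; exists K1; split => //.
  move=> j jK1 hj; have := minK1 j (introT (asboolP _) hj).
  by rewrite leqNgt jK1.
move=> gamma' delta' Fl' x' y' g' HA' g0' hx0' hn'.
have x0i : square_integrable (P := P) (fun w => x' 0%N w - xs).
  rewrite (_ : (fun w => _) = (fun w => x K1 w - xs)) //.
  by apply/funext => w; rewrite hx0'.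
have h0' : (expected_gap P F xs (x' 0%N) <= (2 * (sigma ^+ 2 / mu) * de)%:E)%E.
  rewrite -thE; apply: le_trans hK1; rewrite le_eqVlt; apply/orP; left; apply/eqP.
  by apply: eq_integral => w _; rewrite hx0'.
have bound := decreasing_step_expected_gap cp mu0 xsmin p0 HA' g0' x0i hn' h0'.
have S0 : 0 < S by rewrite -(pmulr_lgt0 _ de0).
have t0 : 0 <= 8 * S / eps by rewrite divr_ge0 ?(ltW eps0) // mulr_ge0 // ltW.
have /andP[tlo thi] := truncn_itv t0.
(* The first integer above [8 S / eps], which makes [8 S / (K2 + 2) <= eps]. *)
set K2 := (Num.truncn (8 * S / eps)).+1 in thi.
have K2le : K2%:R <= 8 * S / eps + 1 by rewrite /K2 -(natr1 (Num.truncn (8 * S / eps))) lerD2r.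
exists K2; split.
  apply: le_trans (bound K2) _; rewrite lee_fin -/S.
  rewrite ler_pdivrMr ?ltr_wpDl // [eps * _]mulrC -ler_pdivrMr //.
  by apply: le_trans (ltW thi) _; rewrite lerDl.
(* From [eps < 2 S de]. Together with [1 <= de^-1], this absorbs additive constants into multiples
   of [S / eps]. *)
have Seps : de^-1 <= 2 * (S / eps).
  by rewrite -(ler_pM2r de0) mulVf ?gt_eqF // mulrA mulrAC ler_pdivlMr // mul1r ltW.
have deV1 : 1 <= de^-1 by rewrite invf_ge1.
have SE : sigma ^+ 2 / (mu * eps) = S / eps by rewrite /S -mulrA invfM.
(* [l] is a real lower bound for the extended logarithm; if the latter is infinite, so is the
   right-hand side. *)
suff [l [hl hK]] : exists l : R,
    (l%:E <= log_plus ((F x0 - F xs) * (eps^-1)%:E))%E /\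
    (K1%:R <= de^-1 * l + 8 * (S / eps) \/
     log_plus ((F x0 - F xs) * (eps^-1)%:E) = +oo%E).
  have [hK'|->] := hK; last first.
    by rewrite mul1e deV gt0_muley ?lte_fin ?invr_gt0 // addye ?leey // -EFinM.
  rewrite mul1e deV SE.
  apply: (@le_trans _ _ ((de^-1)%:E * l%:E + 18%:R%:E * (S / eps)%:E)%E); last first.
    by rewrite leeD2r // lee_wpmul2l // lee_fin invr_ge0 ltW.
  rewrite -!EFinM -EFinD lee_fin natrD.
  by lra.
have [hx|] := ltP (psi x0) +oo%E; last first.
  rewrite leye_eq => /eqP hx; exists 0; split; first exact: log_plus_ge0.
  right; have := gap_pinfty cp xsmin hx; rewrite /gap -/F => ->.
  by rewrite gt0_mulye ?lte_fin ?invr_gt0 // /log_plus /= max_l ?leey.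
have [r hr] := proper_EFin (cp_proper cp) hx.
have [s hs] := minimizer_EFin cp xsmin.
have hG := gapE (f := f) hr hs; set G := (f x0 + r - (f xs + s)) in hG.
have hF : (F x0 - F xs = G%:E)%E by exact: hG.
rewrite hF -EFinM.
have [Gth|Gth] := leP G threshold.
  exists 0; split; [exact: log_plus_ge0|left].
  have : (K1 <= 0)%N.
    by apply: minK1; apply/asboolP; rewrite (expected_gap_cst hx0 hG) lee_fin.
  by rewrite leqn0 => /eqP ->; rewrite mulr0 add0r mulr_ge0 // divr_ge0 // ltW.
have Ge : eps < G by exact: lt_trans epst Gth.
have G0 : 0 < G by exact: lt_trans Ge.
(* The target [eps / 2] is below [S * de], so it meets the threshold while producing a logarithm of
   [G / eps]. *)
have e20 : 0 < eps / 2 by rewrite divr_gt0.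
have [n [hn1 hn2]] := @geometric_small R de (2 * G) (eps / 2) dP e20.
exists (ln (G / eps)); split; first by apply: log_plus_ge_ln; rewrite divr_gt0.
left; have K1n : (K1 <= n)%N.
  apply: minK1; apply/asboolP; apply: le_trans (fin_bound G n hG) _.
  by rewrite lee_fin thE -/S -/de; lra.
have n_le : n%:R <= de^-1 * ln (2 * G / (eps / 2)) + 1 by apply: hn2; lra.
have e4 : 2 * G / (eps / 2) = 4 * (G / eps) by field; rewrite gt_eqF.
(* Then [K1 <= de^-1 * (ln (G / eps) + 3) + 1], and [3 * de^-1 + 1 <= 4 * de^-1 <= 8 * (S /
   eps)]. *)
have ln4 : ln (4 : R) <= 3.
  by have := @le_ln1Dx R 3 _; rewrite (_ : 1 + 3 = 4); [apply; lra|lra].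
rewrite e4 lnM ?posrE ?divr_gt0 // in n_le.
have := ler_wpM2l (ltW (lt_le_trans ltr01 deV1)) ln4.
have : (K1%:R : R) <= n%:R by rewrite ler_nat.
lra.
Qed.
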